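(* Let $M$ be a loopless oriented matroid on a finite ground set $E$. The dual Varchenko--Gelfand filtration is functorial with respect to initial matroids: for any pair of flags of flats $\mathcal F\subset\mathcal F'$ of $M$ and every $p$ we have $\mathcal P_p(M_{\mathcal F'})\subset\mathcal P_p(M_{\mathcal F})$ (inside $\mathbb Z[\mathcal T(M)]$) and $\mathcal A_p(M_{\mathcal F'};\mathbb Z)\subset\mathcal A_p(M_{\mathcal F};\mathbb Z)$ (inside $\mathrm{SFSym}(E)$), and, denoting both inclusions by $\iota$, the following square commutes: $$\begin{array}{ccc}\mathcal P_p(M_{\mathcal F'})&\xrightarrow{\ \tilde a_p\ }&\mathcal A_p(M_{\mathcal F'};\mathbb Z)\\ {\scriptstyle\iota}\downarrow&&\downarrow{\scriptstyle\iota}\\ \mathcal P_p(M_{\mathcal F})&\xrightarrow{\ \tilde a_p\ }&\mathcal A_p(M_{\mathcal F};\mathbb Z),\end{array}$$ where the horizontal maps are the maps $\tilde a_p$ of the oriented matroids $M_{\mathcal F'}$ and $M_{\mathcal F}$ respectively.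
   Context: **Oriented matroids.** An oriented matroid $N$ on $E$ has underlying matroid $\underline N$ and covector set $\mathcal L(N)\subseteq\{0,+,-\}^E$; its topes are the covectors maximal for the coordinatewise order with $0<+$, $0<-$; if $N$ is loopless, $\mathcal T(N)\subseteq\{+,-\}^E$. Flats of $N$ are the sets $E\setminus\mathrm{supp}(L)$, $L\in\mathcal L(N)$. For $T\in\mathcal T(N)$, $T\setminus F$ is $T$ with the coordinates in $F$ set to $0$. For $\mathbf v\in(\mathbb Z/2\mathbb Z)^E$, $T_{\mathbf v}\in\{+,-\}^E$ has $(T_{\mathbf v})_e=(-1)^{\mathbf v_e}$; write $T_{\mathbf v}(e)\in\{\pm1\}$. For a flag of flats $\mathcal F:\emptyset=F_0\subsetneq\dots\subsetneq F_t=E$ of $M$, $M_{\mathcal F}=\bigoplus_{i=0}^{t-1}M|_{F_{i+1}}/F_i$, a loopless oriented matroid on $E$ with tope set $\{T\in\mathcal T(M):T\setminus F_i\in\mathcal L(M)\ \forall i\}$; hence $\mathbb Z[\mathcal T(M_{\mathcal F'})]\subseteq\mathbb Z[\mathcal T(M_{\mathcal F})]\subseteq\mathbb Z[\mathcal T(M)]$ for $\mathcal F\subset\mathcal F'$. **Dual Varchenko--Gelfand filtration** of a loopless oriented matroid $N$ with topes $\mathcal T$: $\mathbb Z[\mathcal T]^*$ is the ring of linear functions on $\mathbb Z[\mathcal T]$ with multiplication pointwise on topes; $h_e(T)=1$ if $T_e=+$, $0$ if $T_e=-$; $\mathcal P^p(N)$ is the set of functions representable by a polynomial of degree $\le p$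 in the $h_e$ ($\mathcal P^{-1}(N)=0$); $\mathcal P_p(N)\subseteq\mathbb Z[\mathcal T]$ is the annihilator of $\mathcal P^{p-1}(N)$. **Prefix chains.** For a complete flag $\mathcal G:\emptyset=G_0\subsetneq\dots\subsetneq G_d=E$ of flats of $N$ (rank $G_i=i$), let $\mathbf d_i$ be the indicator vector of $G_i\setminus G_{i-1}$ and $\mathcal T_{\mathcal G}=\{T\in\mathcal T(N):T\setminus G_i\in\mathcal L(N)\ \forall i\}$. For $T_{\mathbf v}\in\mathcal T_{\mathcal G}$ and $0\le p\le d$ put $\gamma_{\mathcal G,\mathbf v,p}=\sum_{a\in\{0,1\}^p}(-1)^{a_1+\dots+a_p}T_{\mathbf v+\sum a_i\mathbf d_i}\in\mathbb Z[\mathcal T(N)]$. It is known that $\mathcal P_p(N)$ is spanned by these prefix chains. **Cordovil algebra.** $\mathcal A^\bullet(N;\mathbb Z)$ is the quotient of $\mathbb Z[x_i^*:i\in E]$ by the ideal generated by all $(x_i^* )^2$ and all $\sum_{k=1}^tC(i_k)x^*_{i_1}\cdots\widehat{x^*_{i_k}}\cdots x^*_{i_t}$ for circuits $\{i_1,\dots,i_t\}$ of $\underline N$ with $C$ a signed circuit of $N$ supported on it. $\mathrm{SFSym}(E)=\mathbb Z[x_i:i\in E]/\langle x_i^2\rangle$ is paired with $\mathbb Z[x_i^*]/\langle(x_i^* )^2\rangle$ by $\langle(x^* )^S,x^T\rangle=\delta_{S,T}$. $\mathcal A_p(N;\mathbb Z)\subseteq\mathrm{SFSym}(E)$ is the set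 of degree $p$ elements annihilated by the degree $p$ part of the ideal defining $\mathcal A^\bullet(N;\mathbb Z)$. **The map $\tilde a_p$.** $\tilde a_p:\mathcal P_p(N)\to\mathcal A_p(N;\mathbb Z)$ is the well-defined linear map with $\gamma_{\mathcal G,\mathbf v,p}\mapsto\epsilon_{\mathcal G,\mathbf v,p}:=\prod_{i=1}^p\big(\sum_{j\in G_i\setminus G_{i-1}}T_{\mathbf v}(j)x_j\big)$. *)

(* Defs.v *)
From HB Require Import structures.
From mathcomp Require Import all_boot all_order all_algebra.
From mathcomp Require Import mpoly.

Set Implicit Arguments.
Unset Strict Implicit.
Unset Printing Implicit Defensive.

Import GRing.Theory.
Local Open Scope ring_scope.

Variant sign := Zero | Plus | Minus.

Definition sign_code (s : sign) : option bool :=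
  match s with Zero => None | Plus => Some true | Minus => Some false end.
Definition sign_decode (o : option bool) : sign :=
  match o with None => Zero | Some true => Plus | Some false => Minus end.
Lemma sign_codeK : cancel sign_code sign_decode. Proof. by case. Qed.
HB.instance Definition _ := Finite.copy sign (can_type sign_codeK).

Definition sign_int (s : sign) : int :=
  match s with Zero => 0 | Plus => 1 | Minus => -1 end.
Definition sopp (s : sign) : sign :=
  match s with Zero => Zero | Plus => Minus | Minus => Plus end.

Definition signvec (E : finType) := {ffun E -> sign}.

Section SignVectors.
Variable E : finType.
Implicit Types (X Y : signvec E) (A : {set E}).

Definition sv0 : signvec E := [ffun=> Zero].
Definition svopp X : signvec E := [ffun e => sopp (X e)].
Definition svcomp X Y : signvec E := [ffun e => if X e == Zero then Y e else X e].
Definition supp X : {set E} := [set e | X e != Zero].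
Definition sep X Y : {set E} := [set e | (X e != Zero) && (X e == sopp (Y e))].
Definition svle X Y : bool := [forall e, (X e == Zero) || (X e == Y e)].

(* [svset0 F T] is the paper's T \ F. *)
Definition svset0 A X : signvec E := [ffun e => if e \in A then Zero else X e].
Definition svrestr A X : signvec E := [ffun e => if e \in A then X e else Zero].

Definition orth X Y : bool :=
  [disjoint supp X & supp Y] ||
  [exists e, exists f, (sign_int (X e) * sign_int (Y e) == 1) &&
                       (sign_int (X f) * sign_int (Y f) == -1)].

End SignVectors.

Record orientedMatroid (E : finType) := OrientedMatroid {
  covectors :> {set signvec E};
  covector0 : sv0 E \in covectors;
  covectorN : forall X, X \in covectors -> svopp X \in covectors;
  covectorC : forall X Y,
    X \in covectors -> Y \in covectors -> svcomp X Y \in covectors;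
  covectorE : forall X Y e,
    X \in covectors -> Y \in covectors -> e \in sep X Y ->
    exists Z, [/\ Z \in covectors, Z e = Zero &
                  forall f, f \notin sep X Y -> Z f = svcomp X Y f]
}.

Section OrientedMatroidTheory.
Variables (E : finType) (N : orientedMatroid E).

Definition loopless : Prop := forall e : E, exists2 X, X \in covectors N & X e != Zero.

Definition topes : {set signvec E} :=
  [set T in covectors N | [forall X in covectors N, svle T X ==> (X == T)]].

Definition flats : {set {set E}} := [set ~: supp X | X in covectors N].

(* The vectors of N are the sign vectors orthogonal to all covectors; the
   signed circuits are the nonzero vectors of inclusion-minimal support, and
   their supports are the circuits of the underlying matroid. *)
Definition vectors : {set signvec E} :=
  [set V | [forall X in covectors N, orth V X]].
Definition signed_circuits : {set signvec E} :=
  [set C in vectors | (C != sv0 E) &&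
    [forall V in vectors,
       (V != sv0 E) && (supp V \subset supp C) ==> (supp V == supp C)]].

Definition independent (I : {set E}) : bool :=
  [forall C in signed_circuits, ~~ (supp C \subset I)].
Definition rank (A : {set E}) : nat :=
  (\max_(I : {set E} | independent I && (I \subset A)) #|I|)%N.

Definition is_flag (F : seq {set E}) : bool :=
  [&& F != [::], nth setT F 0 == set0, last set0 F == setT,
      sorted (fun A B : {set E} => A \proper B) F & all (mem flats) F].

(* Flags are listed in increasing order F_0, ..., F_t, so t = (size F).-1. *)
Record flag := Flag { flag_seq :> seq {set E}; flagP : is_flag flag_seq }.

Definition flag_nth (F : seq {set E}) (i : nat) : {set E} := nth setT F i.
Definition flag_length (F : seq {set E}) : nat := (size F).-1.
Definition flag_block (F : seq {set E}) (i : nat) : {set E} :=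
  flag_nth F i.+1 :\: flag_nth F i.

Definition complete_flag (G : flag) : Prop :=
  forall i, (i <= flag_length G)%N -> rank (flag_nth G i) = i.

End OrientedMatroidTheory.

Section InitialMatroid.
Variables (E : finType) (M : orientedMatroid E).

(* Covectors of M|_G / F, extended by 0 to E: restriction to G restricts the
   covectors, contraction of F keeps those vanishing on F. *)
Definition minor_covectors (F G : {set E}) : {set signvec E} :=
  [set svrestr (G :\: F) X | X in covectors M & [disjoint supp X & F]].

(* Covectors of the direct sum of the M|_{F_(i+1)} / F_i. *)
Definition initial_covectors (F : seq {set E}) : {set signvec E} :=
  [set X | [forall i : 'I_(flag_length F),
     svrestr (flag_block F i) X
       \in minor_covectors (flag_nth F i) (flag_nth F i.+1)]].

Lemma minorP (F G : {set E}) X :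
  reflect (exists Y, [/\ Y \in covectors M, forall e, e \in F -> Y e = Zero
                       & X = svrestr (G :\: F) Y])
          (X \in minor_covectors F G).
Proof.
apply: (iffP imsetP) => [[Y]|[Y [YM Y0 ->]]].
  rewrite inE => /andP[YM dYF] ->; exists Y; split=> // e eF.
  move/pred0P: dYF => /(_ e); rewrite /= inE eF andbT.
  by case: eqP.
exists Y => //; rewrite inE YM; apply/pred0P => e /=; rewrite inE.
by case eF: (e \in F); rewrite ?andbF // Y0.
Qed.

Lemma initial0 F : sv0 E \in initial_covectors F.
Proof.
rewrite inE; apply/forallP => i; apply/minorP; exists (sv0 E).
by split; [exact: covector0 | move=> e _; rewrite ffunE |].
Qed.

Lemma initialN F X :
  X \in initial_covectors F -> svopp X \in initial_covectors F.
Proof.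
rewrite !inE => /forallP H; apply/forallP => i.
have /minorP[Y [YM Y0 eY]] := H i; apply/minorP; exists (svopp Y); split.
- exact: covectorN.
- by move=> e /Y0; rewrite ffunE => ->.
apply/ffunP => e; have /ffunP/(_ e) := eY; rewrite !ffunE.
by case: ifP => // _ ->.
Qed.

Lemma initialC F X Y : X \in initial_covectors F -> Y \in initial_covectors F ->
  svcomp X Y \in initial_covectors F.
Proof.
rewrite !inE => /forallP HX /forallP HY; apply/forallP => i.
have /minorP[X' [XM X0 eX]] := HX i; have /minorP[Y' [YM Y0 eY]] := HY i.
apply/minorP; exists (svcomp X' Y'); split.
- exact: covectorC.
- by move=> e eF; rewrite ffunE X0 // eqxx Y0.
apply/ffunP => e; have /ffunP/(_ e) := eX; have /ffunP/(_ e) := eY.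
by rewrite !ffunE; case: ifP => // _ -> ->.
Qed.

Lemma flag_mono (F : flag M) i j : (i <= j < size F)%N ->
  flag_nth F i \subset flag_nth F j.
Proof.
have /and5P[_ _ _ sF _] := flagP F; case/andP=> ij jF.
have [->//|ltij] := eqVneq i j.
have trP : transitive (fun A B : {set E} => A \proper B).
  by move=> A B C; exact: proper_trans.
apply: proper_sub; apply: (sorted_ltn_nth trP setT sF); rewrite ?inE //.
  exact: leq_ltn_trans ij jF.
by rewrite ltn_neqAle ltij.
Qed.

Lemma flag_block_disj (F : flag M) i j e :
  (i < flag_length F)%N -> (j < flag_length F)%N ->
  e \in flag_block F i -> e \in flag_block F j -> i = j.
Proof.
wlog ltij : i j / (i <= j)%N => [W iF jF ei ej|iF jF].
  by have [/W|/ltnW/W H] := leqP i j; [exact | exact/esym/H].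
rewrite !inE => /andP[_ ei] /andP[ej _].
apply/eqP; rewrite eqn_leq ltij /= leqNgt; apply/negP => lt.
have/subsetP/(_ _ ei) : flag_nth F i.+1 \subset flag_nth F j.
  apply: flag_mono; rewrite lt /=.
  by apply: leq_trans jF _; exact: leq_pred.
by apply/negP.
Qed.

Lemma flag_block_cover (F : flag M) e :
  exists2 i, (i < flag_length F)%N & e \in flag_block F i.
Proof.
have /and5P[nF /eqP F0 /eqP Ft _ _] := flagP F.
have ex : exists k, (k < size F)%N && (e \in flag_nth F k).
  exists (flag_length F); rewrite /flag_length prednK ?lt0n ?size_eq0 // leqnn /=.
  rewrite /flag_nth nth_last; case: (flag_seq F) nF Ft => //= a s _ ->.
  by rewrite inE.
case: (ex_minnP ex) => -[|k]; first by rewrite /flag_nth F0 inE andbF.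
case/andP=> kF ek kmin; exists k.
  by rewrite /flag_length; case: (size F) kF.
rewrite inE ek andbT; apply/negP => ek'.
by have := kmin k; rewrite ek' (ltnW kF) ltnn => /(_ isT).
Qed.

Lemma initialE (F : flag M) X Y e :
  X \in initial_covectors F -> Y \in initial_covectors F -> e \in sep X Y ->
  exists Z, [/\ Z \in initial_covectors F, Z e = Zero &
                forall f, f \notin sep X Y -> Z f = svcomp X Y f].
Proof.
move=> HX HY eS; have [i iF ei] := flag_block_cover F e.
have HXY := initialC HX HY; move: HX HY HXY; rewrite !inE.
move=> /forallP HX /forallP HY /forallP HXY.
have /minorP[A [AM A0 eA]] := HX (Ordinal iF).
have /minorP[B [BM B0 eB]] := HY (Ordinal iF).
have XA f : f \in flag_block F i -> X f = A f.
  by move=> fi; have /ffunP/(_ f) := eA; rewrite !ffunE /= -/(flag_block F i) fi.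
have YB f : f \in flag_block F i -> Y f = B f.
  by move=> fi; have /ffunP/(_ f) := eB; rewrite !ffunE /= -/(flag_block F i) fi.
have eS' : e \in sep A B by move: eS; rewrite !inE XA // YB.
have [Z [ZM Ze Zf]] := covectorE AM BM eS'.
exists [ffun f => if f \in flag_block F i then Z f else svcomp X Y f]; split.
- rewrite inE; apply/forallP => j; have [ij|ij] := eqVneq (val j) i.
    rewrite ij; apply/minorP; exists Z; split=> //.
      move=> f fF; rewrite Zf ?ffunE; first by rewrite A0 // eqxx B0.
      by rewrite inE A0.
    apply/ffunP => f; rewrite !ffunE -/(flag_block F i).
    by case: (f \in flag_block F i).
  set W := finfun _.
  suff -> : svrestr (flag_block F j) W = svrestr (flag_block F j) (svcomp X Y).
    exact: HXY j.
  apply/ffunP => f; rewrite !ffunE.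
  case fj: (f \in flag_block F j) => //; case fi: (f \in flag_block F i) => //.
  by case/eqP: ij; exact: (flag_block_disj (ltn_ord j) iF fj fi).
- by rewrite ffunE ei.
move=> f fS; rewrite ffunE; case: ifP => // fi; rewrite Zf.
  by rewrite !ffunE XA // YB.
by move: fS; rewrite !inE XA // YB.
Qed.

Definition initial (F : flag M) : orientedMatroid E :=
  @OrientedMatroid E (initial_covectors F) (initial0 F)
    (@initialN F) (@initialC F) (@initialE F).

End InitialMatroid.

(* Z[T(N)] is the group of chains supported on T(N); all of these groups live
   in the free abelian group on {0,+,-}^E. *)
Definition chain (E : finType) := {ffun signvec E -> int}.

(* SFSym(E) = Z[x_i : i in E] / (x_i ^ 2), in its basis of squarefree
   monomials: [f S] is the coefficient of the product of the x_i, i in S. *)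
Definition SFSym (E : finType) := {ffun {set E} -> int}.

(* Z[x_i : i in E], with x_e the variable of index [enum_rank e]. *)
Definition polyE (E : finType) := {mpoly int[#|E|]}.

Section VarchenkoGelfand.
Variables (E : finType) (N : orientedMatroid E).

Definition tope_chain (x : chain E) : Prop :=
  forall T, T \notin topes N -> x T = 0.

Definition heaviside (e : E) (T : signvec E) : int := (T e == Plus)%:R.

(* P^(k-1)(N), as functions on topes: [msize q <= k] says deg q <= k - 1, and
   q = 0 when k = 0. *)
Definition VG_lt (k : nat) (f : signvec E -> int) : Prop :=
  exists2 q : polyE E, (msize q <= k)%N &
    forall T, T \in topes N -> f T = q.@[fun i => heaviside (enum_val i) T].

Definition eval_chain (f : signvec E -> int) (x : chain E) : int :=
  \sum_(T in topes N) x T * f T.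

(* P_p(N), the annihilator of P^(p-1)(N) in Z[T(N)]. *)
Definition dualVG (p : nat) (x : chain E) : Prop :=
  tope_chain x /\ forall f, VG_lt p f -> eval_chain f x = 0.

End VarchenkoGelfand.

Section Cordovil.
Variables (E : finType) (N : orientedMatroid E).

Definition varE (e : E) : polyE E := 'X_(enum_rank e).

Definition sqfree_mon (S : {set E}) : 'X_{1.. #|E|} :=
  [multinom (enum_val i \in S : nat) | i < #|E|].

(* The quotient map Z[x_i] -> Z[x_i] / (x_i ^ 2). *)
Definition sqfree_class (q : polyE E) : SFSym E :=
  [ffun S => q@_(sqfree_mon S)].

Definition circuit_rel (C : signvec E) : polyE E :=
  \sum_(k in supp C) (sign_int (C k))%:MP * \prod_(j in supp C :\ k) varE j.

Definition cordovil_ideal (q : polyE E) : Prop :=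
  exists (a : E -> polyE E) (b : signvec E -> polyE E),
    q = \sum_e a e * varE e ^+ 2 +
        \sum_(C in signed_circuits N) b C * circuit_rel C.

Definition sf_pairing (q : polyE E) (f : SFSym E) : int :=
  \sum_(S : {set E}) sqfree_class q S * f S.

(* A_p(N; Z) *)
Definition cordovil_dual (p : nat) (f : SFSym E) : Prop :=
  (forall S : {set E}, #|S| != p -> f S = 0) /\
  (forall q, q \is p.-homog -> cordovil_ideal q -> sf_pairing q f = 0).

End Cordovil.

Section PrefixChains.
Variables (E : finType) (N : orientedMatroid E).

Definition tope_of (v : {ffun E -> 'Z_2}) : signvec E :=
  [ffun e => if v e == 0 then Plus else Minus].

Definition block_vec (G : seq {set E}) (i : nat) : {ffun E -> 'Z_2} :=
  [ffun e => (e \in flag_block G i)%:R].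

Definition flag_topes (G : flag N) : {set signvec E} :=
  [set T in topes N |
    [forall i : 'I_(size G), svset0 (flag_nth G i) T \in covectors N]].

Definition basis_chain (T : signvec E) : chain E := [ffun U => (U == T)%:R].

(* gamma_{G,v,p}; the index i : 'I_p stands for the paper's i + 1. *)
Definition prefix_chain (G : seq {set E}) (v : {ffun E -> 'Z_2}) (p : nat) :
    chain E :=
  \sum_(a : {ffun 'I_p -> bool})
     basis_chain (tope_of (v + \sum_(i < p) block_vec G i *+ a i))
       *~ (-1) ^+ (\sum_(i < p) a i)%N.

(* epsilon_{G,v,p} *)
Definition prefix_form (G : seq {set E}) (v : {ffun E -> 'Z_2}) (p : nat) :
    SFSym E :=
  sqfree_class (\prod_(i < p) \sum_(j in flag_block G i)
     (sign_int (tope_of v j))%:MP * varE j).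

(* [a] restricts to the map \tilde a_p : P_p(N) -> A_p(N; Z); its values
   outside P_p(N) are irrelevant. *)
Definition is_atilde (p : nat) (a : chain E -> SFSym E) : Prop :=
  [/\ forall x, dualVG N p x -> cordovil_dual N p (a x),
      forall (k : int) x y, dualVG N p x -> dualVG N p y ->
        a (x *~ k + y) = a x *~ k + a y
    & forall (G : flag N) v, complete_flag G -> tope_of v \in flag_topes G ->
        (p <= flag_length G)%N ->
        a (prefix_chain G v p) = prefix_form G v p].

End PrefixChains.

(* Main.v *)
Require Import Defs.
From mathcomp Require Import all_boot all_order all_algebra.
From mathcomp Require Import ring.
From mathcomp Require Import mpoly.

(** All assertions come down to comparing the two initial matroids through data
    that do not mention the flags.

    A tope of the initial matroid of the finer flag F' is a tope of that of F:
    a full sign vector is a tope as soon as its truncations along the flag are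
    covectors of M, and F has fewer truncations than F' ([initial_tope]).
    Functions on the topes for F restrict to functions on the topes for F'
    without increasing the degree, so annihilators are included the other way.

    For the Cordovil side it is enough that the ideal for F is contained in the
    ideal for F'.  If C is a circuit for F, its restriction W to the last block
    of F' that it meets is a vector for F' ([initial_vector]).  The monomial of
    the support of a vector lies in the ideal, and so does the relation of a
    vector, circuit or not ([ideal_vector]); the relation of C is a multiple of
    that of W plus multiples of the monomial of W.

    For the square, define the moment of a chain x at a set S of elements as
    the value of x on the product of the Heaviside functions h_e, e in S.  Then
    P_p consists of the chains of topes whose moments vanish below cardinality
    p, and the map of the statement must send x in P_p to the form whose
    coefficient at S, for S of cardinality p, is the moment of x at S
    ([atilde_moment]).  This formula is the same for all flags.

    It holds on prefix chains by direct computation ([moment_block_form]), so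
    what remains is that prefix chains span P_p ([prefix_span]).  A tope U of
    the contraction of a nonloop d is a face of two topes, one on each side of
    d; taking their difference lifts chains from P_p of the contraction to P_(p+1),
    and prefix chains are iterated lifts of single topes.  That lifts span
    P_(p+1) is shown by deleting one element e: a chain killed by forgetting e
    is itself a lift, and lifts for the deletion are images of lifts.  The
    second point needs that P_p maps onto P_p of a deletion, which is obtained
    in the same induction ([lift_spansP], [del_ontoP]). *)

Set Implicit Arguments.
Unset Strict Implicit.
Unset Printing Implicit Defensive.

Import GRing.Theory.
Local Open Scope ring_scope.

(** * Covectors, minors, free sets and orthogonality *)

Section CovectorSets.
Variable E : finType.
Implicit Types (N : {set signvec E}) (X Y Z T U V S : signvec E).
Implicit Types (I J D : {set E}) (d e f g : E).

(** Deletion and contraction are performed on a fixed ground set, turning the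
    removed elements into loops; stating the axioms for a bare set of sign
    vectors lets inductions pass to minors and compare them by set equality. *)
Record covector_axioms N : Prop := CovectorAxioms {
  cov0 : sv0 E \in N;
  covN : forall X, X \in N -> svopp X \in N;
  covC : forall X Y, X \in N -> Y \in N -> svcomp X Y \in N;
  covE : forall X Y e, X \in N -> Y \in N -> e \in sep X Y ->
    exists Z, [/\ Z \in N, Z e = Zero &
                  forall f, f \notin sep X Y -> Z f = svcomp X Y f]
}.

Definition nonloop N e := [exists X in N, X e != Zero].

(** Topes in the presence of loops: covectors whose support is as large as the
    loops permit. *)
Definition tope N T := (T \in N) && [forall e, nonloop N e ==> (T e != Zero)].

Definition contraction d N := [set X in N | X d == Zero].
Definition deletion e N := [set svset0 [set e] X | X in N].

Lemma nonloopP N e : reflect (exists2 X, X \in N & X e != Zero) (nonloop N e).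
Proof. exact: exists_inP. Qed.

Lemma loopE N e X : ~~ nonloop N e -> X \in N -> X e = Zero.
Proof.
by move=> /existsPn/(_ X) H XN; move: H; rewrite XN /= negbK => /eqP.
Qed.

Lemma topeP N T :
  reflect (T \in N /\ forall e, nonloop N e -> T e != Zero) (tope N T).
Proof.
apply: (iffP andP) => [] [TN H]; split=> //.
  by move=> e; move/forallP: H => /(_ e)/implyP.
by apply/forallP=> e; apply/implyP/H.
Qed.

Lemma in_con d N X : (X \in contraction d N) = (X \in N) && (X d == Zero).
Proof. by rewrite inE. Qed.

Lemma svoppE X e : svopp X e = sopp (X e). Proof. by rewrite ffunE. Qed.

Lemma svcompE X Y e : svcomp X Y e = if X e == Zero then Y e else X e.
Proof. by rewrite ffunE. Qed.

Lemma svset0E D X e : svset0 D X e = if e \in D then Zero else X e.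
Proof. by rewrite ffunE. Qed.

Lemma con_axioms d N : covector_axioms N -> covector_axioms (contraction d N).
Proof.
move=> oN; split.
- by rewrite in_con (cov0 oN) ffunE eqxx.
- by move=> X; rewrite !in_con svoppE => /andP[/(covN oN) -> /eqP ->].
- move=> X Y; rewrite !in_con svcompE => /andP[XN ->] /andP[YN ->].
  by rewrite (covC oN).
- move=> X Y e; rewrite !in_con => /andP[XN /eqP Xd] /andP[YN /eqP Yd] eS.
  have [Z [ZN Ze Zf]] := covE oN XN YN eS; exists Z; split=> //.
  by rewrite in_con ZN Zf ?svcompE ?inE Xd ?Yd.
Qed.

Lemma del_axioms e N : covector_axioms N -> covector_axioms (deletion e N).
Proof.
move=> oN; split.
- apply/imsetP; exists (sv0 E); first exact: (cov0 oN).
  by apply/ffunP=> f; rewrite svset0E !ffunE; case: ifP.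
- move=> _ /imsetP[X XN ->]; apply/imsetP; exists (svopp X).
    exact: (covN oN).
  by apply/ffunP=> f; rewrite svset0E !svoppE svset0E; case: ifP.
- move=> _ _ /imsetP[X XN ->] /imsetP[Y YN ->].
  apply/imsetP; exists (svcomp X Y); first exact: (covC oN).
  by apply/ffunP=> f; rewrite !(svset0E, svcompE); case: (f \in _).
- move=> _ _ f /imsetP[X XN ->] /imsetP[Y YN ->].
  rewrite !inE !svset0E !inE; case: ifP => //= fe fS.
  have [|Z [ZN Zf Zg]] := covE oN XN YN (e := f); first by rewrite inE.
  exists (svset0 [set e] Z); split; first exact: imset_f.
    by rewrite svset0E inE fe.
  move=> g; rewrite !inE !(svset0E, svcompE) !inE.
  by case: ifP => //= ge gS; rewrite Zg ?svcompE ?inE.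
Qed.

(** A covector of largest support works, since composing it with another covector
    never shrinks the support. *)
Lemma tope_exists N : covector_axioms N -> exists T, tope N T.
Proof.
move=> oN; have [T TN Tmax] := arg_maxnP (fun X => #|supp X|) (cov0 oN).
exists T; apply/topeP; split=> // e /nonloopP[X XN Xe]; apply/negP=> /eqP Te.
have /Tmax := covC oN TN XN; apply/negP; rewrite -ltnNge.
apply/proper_card/properP; split.
  by apply/subsetP=> f; rewrite !inE svcompE; case: (T f).
  by exists e; rewrite !inE ?svcompE Te.
Qed.

Lemma sv_sub_nonloop N X e : X \in N -> X e != Zero -> nonloop N e.
Proof. by move=> XN Xe; apply/nonloopP; exists X. Qed.

Lemma nonloop_con N d e : nonloop (contraction d N) e -> nonloop N e.
Proof.
by case/nonloopP=> X; rewrite in_con => /andP[XN _]; exact: sv_sub_nonloop.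
Qed.

Lemma con_loop N d : ~~ nonloop (contraction d N) d.
Proof.
by apply/nonloopP=> -[X]; rewrite in_con => /andP[_ /eqP->].
Qed.

(** Elimination without hypothesis on the signs at e.  Replacing Y by its opposite
    if necessary makes e separating, at the price of controlling the result
    only where Y vanishes. *)
Lemma eliminate N X Y e : covector_axioms N -> X \in N -> Y \in N ->
  Y e != Zero ->
  exists Z, [/\ Z \in N, Z e = Zero & forall f, Y f = Zero -> Z f = X f].
Proof.
move=> oN XN YN Ye; have [Xe|Xe] := eqVneq (X e) Zero; first by exists X.
wlog opp : Y YN Ye / X e = sopp (Y e).
  move=> W; have [|ne] := eqVneq (X e) (sopp (Y e)); first exact: W.
  have Ye' : svopp Y e != Zero by rewrite svoppE; case: (Y e) Ye.
  have XYe : X e = sopp (svopp Y e).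
    by rewrite svoppE; move: Xe Ye ne; case: (X e); case: (Y e).
  have [Z [ZN Ze Zf]] := W _ (covN oN YN) Ye' XYe.
  exists Z; split=> // f Yf; apply: Zf; by rewrite svoppE Yf.
have [|Z [ZN Ze Zf]] := covE oN XN YN (e := e); first by rewrite inE Xe opp eqxx.
exists Z; split=> // f Yf; rewrite Zf ?inE ?svcompE Yf; first by case: eqP.
by case: (X f).
Qed.

(** The parallel class of d: the nonloops that become loops when d is contracted. *)
Definition parallel_class N d :=
  [set f | nonloop N f && ~~ nonloop (contraction d N) f].

(** Exchange for a single element.  If X vanished at f but not at d, then
    eliminating d between X and a covector nonzero at f would produce a covector
    showing that f is not a loop after contracting d. *)
Lemma cls_loop N d f : covector_axioms N -> f \in parallel_class N d ->
  forall X, X \in N -> (X f == Zero) = (X d == Zero).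
Proof.
move=> oN; rewrite inE => /andP[nf lf] X XN; apply/eqP/eqP=> [Xf|Xd]; last first.
  by apply: (loopE lf); rewrite in_con XN Xd eqxx.
apply/eqP/negPn/negP=> Xd; have /nonloopP[Y YN Yf] := nf.
have [Z [ZN Zd Zf]] := eliminate oN YN XN Xd.
by move: Yf; rewrite -Zf // (loopE lf) ?eqxx // in_con ZN Zd eqxx.
Qed.

(** Independence seen from the covectors: no constraint relates the signs on I.
    Full sign patterns are enough (see [free_pattern]), and restricting to them
    makes minimal nonfree sets easy to analyse. *)
Definition free_set N I := [forall S : signvec E, (I \subset supp S) ==>
  [exists X in N, [forall e in I, X e == S e]]].

Lemma free_setP N I : reflect
  (forall S, (forall e, e \in I -> S e != Zero) ->
     exists2 X, X \in N & forall e, e \in I -> X e = S e) (free_set N I).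
Proof.
apply: (iffP forallP) => H S.
  move=> SI; have /implyP/(_ _)/exists_inP[|X XN XS] := H S.
    by apply/subsetP=> e /SI; rewrite inE.
  by exists X => // e; move/forall_inP: XS => /(_ e) h /h /eqP.
apply/implyP=> /subsetP SI; have [|X XN XS] := H S.
  by move=> e /SI; rewrite inE.
by apply/exists_inP; exists X => //; apply/forall_inP=> e /XS ->.
Qed.

Lemma free_sub N I J : J \subset I -> free_set N I -> free_set N J.
Proof.
move=> /subsetP JI /free_setP fI; apply/free_setP=> S SJ.
have [e|X XN XS] := fI [ffun e => if e \in J then S e else Plus].
  by rewrite ffunE; case: ifP => // /SJ.
by exists X => // e eJ; rewrite XS ?ffunE ?eJ // JI.
Qed.

(** Zeros in the pattern are created one at a time: eliminate e between covectors
    realizing the two patterns that are nonzero at e. *)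
Lemma free_pattern N I : covector_axioms N -> free_set N I ->
  forall S, exists2 X, X \in N & forall e, e \in I -> X e = S e.
Proof.
move=> oN fI S; have [n] := ubnP #|I :\: supp S|.
elim: n S => // n IHn S; rewrite ltnS => le_n.
have [/eqP|[e]] := set_0Vmem (I :\: supp S).
  rewrite setD_eq0 => /subsetP IS; apply: (free_setP _ _ fI).
  by move=> e /IS; rewrite inE.
rewrite !inE negbK => /andP[/eqP Se eI].
pose Sx s : signvec E := [ffun f => if f == e then s else S f].
have IHs s : s != Zero -> exists2 X, X \in N & forall f, f \in I -> X f = Sx s f.
  move=> s0; apply: IHn; apply: leq_trans le_n.
  apply: proper_card; apply/properP; split.
    apply/subsetP=> f; rewrite !inE !ffunE; case: (eqVneq f e) => [->|//].
    by rewrite s0.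
  by exists e; rewrite !inE ?Se ?eI // !ffunE eqxx s0.
have [//|X XN XS] := IHs Plus; have [//|Y YN YS] := IHs Minus.
have [|Z [ZN Ze Zf]] := covE oN XN YN (e := e).
  by rewrite inE XS // YS // !ffunE eqxx.
exists Z => // f fI'; have [->|fe] := eqVneq f e; first by rewrite Ze Se.
have Xf : X f = S f by rewrite XS // ffunE (negPf fe).
have Yf : Y f = S f by rewrite YS // ffunE (negPf fe).
by rewrite Zf ?inE ?svcompE Xf Yf; case: (S f).
Qed.

Lemma orthN V X : orth V (svopp X) = orth V X.
Proof.
rewrite /orth; congr (_ || _).
  congr (_ : bool); rewrite /supp; apply: eq_disjoint_r => e; rewrite !inE svoppE.
  by case: (X e).
have sN e : sign_int (V e) * sign_int (svopp X e) =
    - (sign_int (V e) * sign_int (X e)).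
  by rewrite svoppE; case: (X e); case: (V e).
apply/existsP/existsP=> -[e /existsP[f /andP[h1 h2]]];
  exists f; apply/existsP; exists e.
all: by move: h1 h2; rewrite !sN !eqr_oppLR ?opprK => -> ->.
Qed.

(** The part of oriented matroid duality that is needed: a nonfree set carries a
    nonzero vector.  Let J be a minimal nonfree subset and V a full pattern on J
    that no covector realizes.  If V were not orthogonal to X, then up to sign X
    would agree with V on the elements of J in its support; for e one of these,
    minimality gives Y that agrees with V on J minus e, and the composition of X
    with Y would realize V. *)
Lemma dependent_vector N I : covector_axioms N -> ~~ free_set N I ->
  exists V, [/\ V != sv0 E, supp V \subset I & forall X, X \in N -> orth V X].
Proof.
move=> oN nfI.
have [J /minsetP[nfJ minJ] JI] := @minset_exists _ (fun J => ~~ free_set N J) I nfI.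
have [S SJ nS] : exists2 S, J \subset supp S &
    ~ exists2 X, X \in N & forall e, e \in J -> X e = S e.
  move: nfJ => /forallPn[S]; rewrite negb_imply => /andP[SJ nS]; exists S => //.
  case=> X XN XS; case/exists_inP: nS; exists X => //.
  by apply/forall_inP=> e /XS ->.
pose V := svrestr J S.
have sV : supp V = J.
  apply/setP=> e; rewrite inE ffunE; case: ifP => [eJ|]; last by rewrite eqxx.
  by move/subsetP: SJ => /(_ e eJ); rewrite inE.
have J0 : J != set0.
  by apply/eqP=> J0; apply: nS; exists (sv0 E); [exact: cov0|move=> e; rewrite J0 inE].
exists V; split.
- apply/eqP=> V0; case/set0Pn: J0 => e; rewrite -sV inE V0 ffunE eqxx //.
- by rewrite sV.
move=> X XN; apply/negPn/negP; move=> nor.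
have [e [eJ Xe]] : exists e, e \in J /\ X e != Zero.
  move: nor; rewrite negb_or => /andP[/pred0Pn[e] /=] /andP[].
  by rewrite sV => eJ; rewrite inE => Xe _; exists e.
wlog pe : X XN nor Xe / X e = V e.
  move=> W; have Ve : V e != Zero by move: eJ; rewrite -sV inE.
  have [|ne] := eqVneq (X e) (V e); first exact: W.
  apply: (W (svopp X)); rewrite ?orthN ?(covN oN) ?svoppE //.
    by case: (X e) Xe.
  by move: Xe Ve ne; case: (X e); case: (V e).
have agree f : f \in J -> X f != Zero -> X f = V f.
  move=> fJ Xf; apply/eqP/negPn/negP=> nf; case/negP: nor.
  apply/orP; right; apply/existsP; exists e; apply/existsP; exists f.
  have Vf : V f != Zero by move: fJ; rewrite -sV inE.
  rewrite pe; have Ve : V e != Zero by move: eJ; rewrite -sV inE.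
  by move: Ve Vf Xf nf; case: (V e); case: (V f); case: (X f).
have : free_set N (J :\ e).
  apply/negPn/negP=> nf; have /minJ : J :\ e \subset J by apply: subD1set.
  by move=> /(_ nf) /setP/(_ e); rewrite !inE eqxx eJ.
case/free_setP/(_ S) => [f|Y YN YS].
  by rewrite !inE => /andP[_ fJ]; move/subsetP: SJ => /(_ f fJ); rewrite inE.
apply: nS; exists (svcomp X Y); first exact: (covC oN).
move=> f fJ; rewrite svcompE; case: eqP => [Xf|/eqP Xf].
  apply: YS; rewrite !inE fJ andbT; apply: contraNneq Xe => <-; exact/eqP.
by rewrite agree // ffunE fJ.
Qed.

Lemma vector_not_free N V : V != sv0 E -> (forall X, X \in N -> orth V X) ->
  ~~ free_set N (supp V).
Proof.
move=> V0 oV; apply/negP=> /free_setP/(_ V)[e|X XN XV]; first by rewrite inE.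
have /orP[] := oV X XN.
  have [e Ve] : exists e, V e != Zero.
    apply/existsP; apply: contraNT V0 => /existsPn H; apply/eqP/ffunP=> e.
    by rewrite ffunE; move: (H e); rewrite negbK => /eqP.
  by move=> /pred0P/(_ e) /=; rewrite !inE XV ?inE Ve.
case/existsP=> e /existsP[f /andP[_]].
have [Vf|Vf] := eqVneq (V f) Zero; first by rewrite Vf mul0r.
by rewrite XV ?inE //; case: (V f).
Qed.

(** Removing k from the support of V leaves a free set, so for each other f some
    covector meets the support of V exactly in f, and perhaps k.  Orthogonality
    to it determines the sign at f from the sign at k, for V as for W. *)
Lemma vector_unique N V W k : covector_axioms N ->
  (forall X, X \in N -> orth V X) -> (forall X, X \in N -> orth W X) ->
  supp W \subset supp V -> V k != Zero -> V k = W k -> free_set N (supp V :\ k) ->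
  V = W.
Proof.
move=> oN oV oW WV Vk VWk fI; apply/ffunP=> f.
have [->//|fk] := eqVneq f k.
have [Vf|Vf] := eqVneq (V f) Zero.
  rewrite Vf; apply/esym/eqP/negPn/negP=> Wf.
  by move/subsetP: WV => /(_ f); rewrite !inE Vf Wf => /(_ isT).
have [X XN XS] := free_pattern oN fI [ffun g => if g == f then V f else Zero].
have Xf : X f = V f by rewrite XS ?ffunE ?eqxx // !inE fk.
have X0 g : g != k -> g != f -> V g != Zero -> X g = Zero.
  by move=> gk gf Vg; rewrite XS ?ffunE ?(negPf gf) // !inE gk.
have key U : orth U X -> (forall g, U g != Zero -> V g != Zero) -> U k != Zero ->
    sign_int (U f) * sign_int (X f) + sign_int (U k) * sign_int (X k) = 0.
  move=> oU UV Uk.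
  have prod0 g : g != k -> g != f -> sign_int (U g) * sign_int (X g) = 0.
    move=> gk gf; have [->|Ug] := eqVneq (U g) Zero; first by rewrite mul0r.
    by rewrite X0 ?mulr0 // UV.
  case/orP: oU => [/pred0P dis|/existsP[g /existsP[h /andP[/eqP hg /eqP hh]]]].
    have p0 g : sign_int (U g) * sign_int (X g) = 0.
      have := dis g; rewrite /= !inE; case: (U g); rewrite ?mul0r //=;
        by case: (X g).
    by rewrite !p0.
  have gkf : (g == k) || (g == f).
    by apply: contra_eqT hg => /norP[gk gf]; rewrite prod0.
  have hkf : (h == k) || (h == f).
    by apply: contra_eqT hh => /norP[gk gf]; rewrite prod0.
  case/orP: gkf hg => /eqP-> hg; case/orP: hkf hh => /eqP-> hh.
  - by rewrite hg in hh.
  - by rewrite hg hh.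
  - by rewrite hg hh.
  - by rewrite hg in hh.
have Wk : W k != Zero by rewrite -VWk.
have KV := key V (oV X XN) (fun g h => h) Vk.
have WV' g : W g != Zero -> V g != Zero.
  by move/subsetP: WV => /(_ g); rewrite !inE.
have := key W (oW X XN) WV' Wk; move: KV Vf Vk; rewrite -VWk Xf.
by case: (V f); case: (V k); case: (W f); case: (X k).
Qed.

End CovectorSets.

(** * Initial matroids of nested flags *)

Section Initial.
Variable E : finType.
Implicit Types (X Y Z T U V W : signvec E) (e f : E) (I J D S : {set E}).

Lemma om_axioms (N : orientedMatroid E) : covector_axioms N.
Proof.
by split; [exact: covector0|exact: covectorN|exact: covectorC|exact: covectorE].
Qed.

Lemma mem_topes (N : orientedMatroid E) T : (T \in topes N) = tope N T.
Proof.
have oN := om_axioms N; rewrite inE; apply/andP/topeP=> -[TN H]; split=> //.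
  have [U /topeP[UN U0]] := tope_exists oN.
  move=> e /U0; have TU := covC oN TN UN.
  move/forall_inP: H => /(_ _ TU) /implyP H.
  have /eqP/ffunP/(_ e) : svcomp T U == T.
    apply: H; apply/forallP=> g; rewrite svcompE.
    by case: (T g == Zero) => //=; rewrite eqxx.
  by rewrite svcompE; case: eqP => // -> ->.
apply/forall_inP=> X XN; apply/implyP=> /forallP le; apply/eqP/ffunP=> e.
have [Xe|Xe] := eqVneq (X e) Zero; last first.
  have Te := H e (sv_sub_nonloop XN Xe).
  by have := le e; rewrite (negPf Te) => /eqP ->.
have [Te|Te] := eqVneq (T e) Zero; first by rewrite Te.
by have := le e; rewrite (negPf Te) => /eqP ->.
Qed.

Variable M : orientedMatroid E.

Lemma in_initial (F : seq {set E}) X : reflect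
  (forall i, (i < flag_length F)%N -> exists Y, [/\ Y \in covectors M,
     forall e, e \in flag_nth F i -> Y e = Zero &
     forall e, e \in flag_block F i -> X e = Y e])
  (X \in initial_covectors M F).
Proof.
rewrite inE; apply: (iffP forallP) => H i.
  move=> iF; have /minorP[Y [YM Y0 XY]] := H (Ordinal iF); exists Y; split=> //.
  move=> e eF; have := XY; rewrite -/(flag_block F i) => /ffunP/(_ e).
  by rewrite !ffunE eF.
have [Y [YM Y0 XY]] := H i (ltn_ord i); apply/minorP; exists Y; split=> //.
apply/ffunP=> e; rewrite !ffunE -/(flag_block F i).
by case: ifP => // /XY.
Qed.

Lemma flag_size (F : flag M) : size F = (flag_length F).+1.
Proof.
by have /and5P[nF _ _ _ _] := flagP F; rewrite prednK // lt0n size_eq0.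
Qed.

Lemma flag_nth_flat (F : flag M) i : (i <= flag_length F)%N ->
  exists2 X, X \in covectors M & forall e, (X e == Zero) = (e \in flag_nth F i).
Proof.
move=> iF; have /and5P[_ _ _ _ /allP flF] := flagP F.
have /imsetP[X XM FX] : flag_nth F i \in flats M.
  by apply: flF; rewrite mem_nth // flag_size ltnS.
by exists X => // e; rewrite FX !inE negbK.
Qed.

Lemma initial_nonloop (F : flag M) e : nonloop (initial F) e.
Proof.
have [i iF ei] := flag_block_cover F e.
have [X XM X0] := flag_nth_flat (ltnW iF).
apply/nonloopP; exists (svrestr (flag_block F i) X); last first.
  by rewrite ffunE ei X0; move: ei; rewrite inE => /andP[].
apply/in_initial => j jF; have [->|ji] := eqVneq j i.
  exists X; split=> // f; first by rewrite -X0 => /eqP.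
  by move=> fi; rewrite ffunE fi.
exists (sv0 E); split; first exact: covector0.
  by move=> f _; rewrite ffunE.
move=> f fj; rewrite !ffunE; case: ifP => // fi.
by case/eqP: ji; apply: flag_block_disj fj fi.
Qed.

(** Descending induction along the flag: the truncation at F_j is the truncation
    at F_(j+1) composed with a covector that vanishes on F_j and agrees with T
    on the block between them. *)
Lemma initial_truncate (F : flag M) T : T \in initial_covectors M F ->
  (forall e, T e != Zero) -> forall i, (i <= flag_length F)%N ->
  svset0 (flag_nth F i) T \in covectors M.
Proof.
have /and5P[_ _ /eqP Flast _ _] := flagP F.
move=> /in_initial TF T0 i iF; rewrite -(subKn iF).
have : (flag_length F - i <= flag_length F)%N by apply: leq_subr.
elim: (_ - i)%N => [_|k IHk kF].
  suff -> : svset0 (flag_nth F (flag_length F - 0)) T = sv0 E by exact: covector0.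
  apply/ffunP=> e; rewrite !ffunE subn0 /flag_nth /flag_length nth_last.
  have /and5P[nF _ _ _ _] := flagP F.
  by case: (flag_seq F) nF Flast => //= a s _ ->; rewrite inE.
have {}IHk := IHk (ltnW kF); set j := (flag_length F - k.+1)%N.
have jS : j.+1 = (flag_length F - k)%N by rewrite /j subnSK.
have jF : (j < flag_length F)%N by rewrite jS leq_subr.
have [Y [YM Y0 TY]] := TF _ jF.
suff -> : svset0 (flag_nth F j) T =
    svcomp (svset0 (flag_nth F (flag_length F - k)) T) Y.
  exact: covectorC.
apply/ffunP=> e; rewrite svcompE !svset0E -jS.
have /subsetP/(_ e) : flag_nth F j \subset flag_nth F j.+1.
  by apply: flag_mono; rewrite leqnSn flag_size ltnS.
have := TY e; rewrite inE.
case ej: (e \in flag_nth F j); case: (e \in flag_nth F j.+1) => //=.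
- by rewrite Y0.
- by move=> _ /(_ isT).
- by move=> /(_ isT) ->.
- by rewrite (negPf (T0 e)).
Qed.

Variables F F' : flag M.
Hypothesis subF : {subset flag_seq F <= flag_seq F'}.

Lemma subflag_nth i : (i <= flag_length F)%N ->
  exists2 k, (k <= flag_length F')%N & flag_nth F i = flag_nth F' k.
Proof.
move=> iF; have /subF/(nthP setT)[k kF' eq] : flag_nth F i \in flag_seq F.
  by apply: mem_nth; rewrite flag_size ltnS.
by exists k; rewrite // -ltnS -flag_size.
Qed.

Lemma subflag_block j e : (j < flag_length F')%N -> e \in flag_block F' j ->
  exists i, [/\ (i < flag_length F)%N, flag_nth F i \subset flag_nth F' j,
    flag_nth F' j.+1 \subset flag_nth F i.+1 &
    flag_block F' j \subset flag_block F i].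
Proof.
move=> jF' ej; have [i iF ei] := flag_block_cover F e; exists i.
move: ei ej; rewrite !inE => /andP[ei eiS] /andP[ej ejS].
have [k kF' eq] := subflag_nth iF; have [l lF' eq'] := subflag_nth (ltnW iF).
have lj : flag_nth F i \subset flag_nth F' j.
  rewrite eq'; have [lj|jl] := leqP l j.
    by apply: flag_mono; rewrite lj flag_size ltnS ltnW.
  have /subsetP/(_ e ejS) : flag_nth F' j.+1 \subset flag_nth F' l.
    by apply: flag_mono; rewrite jl flag_size ltnS.
  by rewrite -eq' (negPf ei).
have kj : flag_nth F' j.+1 \subset flag_nth F i.+1.
  rewrite eq; have [jk|kj] := ltnP j k.
    by apply: flag_mono; rewrite jk flag_size ltnS.
  have /subsetP/(_ e) : flag_nth F' k \subset flag_nth F' j.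
    by apply: flag_mono; rewrite kj flag_size ltnS ltnW.
  by rewrite -eq eiS (negPf ej) => /(_ isT).
split=> //; apply: setDSS => //.
Qed.

Lemma initial_tope T : tope (initial F') T -> tope (initial F) T.
Proof.
move=> /topeP[TF' T0]; have {}T0 e : T e != Zero by apply/T0/initial_nonloop.
apply/topeP; split=> //; apply/in_initial => i iF.
have [k kF' eq] := subflag_nth (ltnW iF).
exists (svset0 (flag_nth F i) T); split.
- by rewrite eq; apply: initial_truncate.
- by move=> e ei; rewrite svset0E ei.
- by move=> e; rewrite inE svset0E => /andP[/negPf->].
Qed.

Lemma orth_prod X Y X' Y' :
  (forall e, sign_int (X e) * sign_int (Y e) = sign_int (X' e) * sign_int (Y' e)) ->
  orth X Y -> orth X' Y'.
Proof.
move=> H /orP[/pred0P dis|/existsP[e /existsP[f]]].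
  apply/orP; left; apply/pred0P=> e /=; rewrite !inE.
  have := dis e; have := H e; rewrite /= !inE.
  by case: (X e); case: (Y e); case: (X' e); case: (Y' e).
rewrite !H => ef; apply/orP; right.
by apply/existsP; exists e; apply/existsP; exists f.
Qed.

(** W is the restriction of V to the last block of F' that meets the support of V.
    On that block, a covector X for F' is the restriction of a covector Y of M
    that vanishes before the block; cut down to the block of F around it, Y is a
    covector of the coarser initial matroid and has the same products with V as
    X with W. *)
Lemma initial_vector V : V != sv0 E ->
  (forall X, X \in covectors (initial F) -> orth V X) ->
  exists W, [/\ W != sv0 E, forall e, W e != Zero -> W e = V e &
             forall X, X \in covectors (initial F') -> orth W X].
Proof.
move=> V0 oV.
have [e0 Ve0] : exists e, V e != Zero.
  apply/existsP; apply: contraNT V0 => /existsPn H; apply/eqP/ffunP=> e.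
  by rewrite ffunE; move: (H e); rewrite negbK => /eqP.
pose P (j : 'I_(flag_length F')) := [exists e in flag_block F' j, V e != Zero].
have [j0 j0F' e0j0] := flag_block_cover F' e0.
have Pj0 : P (Ordinal j0F') by apply/exists_inP; exists e0.
have [j /exists_inP[e1 e1j Ve1] jmax] := arg_maxnP (fun j : 'I__ => j : nat) Pj0.
exists (svrestr (flag_block F' j) V); split.
- by apply: contraNneq Ve1 => /ffunP/(_ e1); rewrite !ffunE e1j => ->.
- by move=> e; rewrite ffunE; case: ifP.
move=> X /in_initial/(_ j (ltn_ord j)) [Y [YM Y0 XY]].
have [i [iF Fij Fji bl]] := subflag_block (ltn_ord j) e1j.
apply: (orth_prod (X := V) (Y := svrestr (flag_block F i) Y)); last first.
  apply: oV; apply/in_initial => k kF; have [->|ki] := eqVneq k i.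
    exists Y; split=> // e; first by move/(subsetP Fij)/Y0.
    by move=> ei; rewrite ffunE ei.
  exists (sv0 E); split; first exact: covector0.
    by move=> e _; rewrite ffunE.
  move=> e ek; rewrite !ffunE; case: ifP => // ei.
  by case/eqP: ki; apply: flag_block_disj ek ei.
move=> e; rewrite !ffunE; case: ifP => ei; case: ifP => ej.
- by rewrite XY.
- rewrite mul0r; move: ej; rewrite inE; case ej: (e \in _) => /=.
    by rewrite Y0 ?mulr0.
  move=> ejS; suff -> : V e = Zero by rewrite mul0r.
  apply/eqP/negPn/negP=> Ve; have [k kF' ek] := flag_block_cover F' e.
  have /jmax /= kj : P (Ordinal kF') by apply/exists_inP; exists e.
  move: ek; rewrite inE => /andP[ek ekS].
  have /subsetP/(_ e ekS) : flag_nth F' k.+1 \subset flag_nth F' j.+1.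
    by apply: flag_mono; rewrite flag_size !ltnS kj ltn_ord.
  by rewrite ejS.
- by move/subsetP: bl => /(_ e ej); rewrite ei.
- by rewrite mul0r mulr0.
Qed.

End Initial.

(** * The Cordovil ideal of an initial matroid *)

Section Ideal.
Variables (E : finType) (N : orientedMatroid E).
Implicit Types (X Y Z T U V W C : signvec E) (e f k : E) (I J D S : {set E}).
Implicit Types q r : polyE E.

Local Notation ideal := (cordovil_ideal N).

Lemma ideal0 : ideal 0.
Proof.
by exists (fun=> 0), (fun=> 0); rewrite !big1 ?addr0 // => *; rewrite mul0r.
Qed.

Lemma idealD q r : ideal q -> ideal r -> ideal (q + r).
Proof.
move=> [a [b ->]] [a' [b' ->]].
exists (fun e => a e + a' e), (fun C => b C + b' C).
under [X in _ = X + _]eq_bigr do rewrite mulrDl.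
under [X in _ = _ + X]eq_bigr do rewrite mulrDl.
by rewrite !big_split /= addrACA.
Qed.

Lemma idealM r q : ideal q -> ideal (r * q).
Proof.
move=> [a [b ->]]; exists (fun e => r * a e), (fun C => r * b C).
rewrite mulrDr !mulr_sumr.
by congr (_ + _); apply: eq_bigr => i _; rewrite mulrA.
Qed.

Lemma idealN q : ideal q -> ideal (- q).
Proof. by move=> Iq; rewrite -mulN1r; apply: idealM. Qed.

Lemma ideal_sum (I : Type) (s : seq I) (P : pred I) (F : I -> polyE E) :
  (forall i, P i -> ideal (F i)) -> ideal (\sum_(i <- s | P i) F i).
Proof. by move=> H; apply: big_ind => //; [exact: ideal0|exact: idealD]. Qed.

Lemma ideal_sq e : ideal (varE e ^+ 2).
Proof.
exists (fun f => (f == e)%:R), (fun=> 0).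
rewrite [X in _ + X]big1 ?addr0; last by move=> *; rewrite mul0r.
rewrite (bigD1 e) //= eqxx mul1r big1 ?addr0 // => f /negPf->.
by rewrite mul0r.
Qed.

Lemma ideal_circuit C : C \in signed_circuits N -> ideal (circuit_rel C).
Proof.
move=> CN; exists (fun=> 0), (fun U => (U == C)%:R).
rewrite [X in X + _]big1 ?add0r; last by move=> *; rewrite mul0r.
rewrite (bigD1 C) //= eqxx mul1r big1 ?addr0 // => f /andP[_ /negPf->].
by rewrite mul0r.
Qed.

Lemma in_vectors V :
  reflect (forall X, X \in covectors N -> orth V X) (V \in vectors N).
Proof. by rewrite inE; apply: forall_inP. Qed.

Lemma vector_circuit V : V \in vectors N -> V != sv0 E ->
  exists2 C, C \in signed_circuits N & supp C \subset supp V.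
Proof.
move=> VN V0.
pose P U := [&& U \in vectors N, U != sv0 E & supp U \subset supp V].
have PV : P V by rewrite /P VN V0 subxx.
have [C /and3P[CN C0 CV] Cmin] := arg_minnP (fun U => #|supp U|) PV.
exists C => //; rewrite inE CN C0; apply/forall_inP=> U UN.
apply/implyP=> /andP[U0 UC]; rewrite eqEcard UC /=; apply: Cmin.
by rewrite /P UN U0 (subset_trans UC CV).
Qed.

Lemma independent_free I : independent N I = free_set N I.
Proof.
apply/idP/idP=> [/forall_inP H|fI].
  apply/negPn/negP=> nf; have [V [V0 VI oV]] := dependent_vector (om_axioms N) nf.
  have /in_vectors VN := oV.
  have [C CN CV] := vector_circuit VN V0.
  by have /negP := H C CN; apply; exact: subset_trans CV VI.
apply/forall_inP=> C; rewrite inE => /and3P[/in_vectors oC C0 _].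
apply/negP=> CI; have /negP := vector_not_free C0 oC; apply.
exact: free_sub CI fI.
Qed.

Lemma dependent_circuit I : ~~ free_set N I ->
  exists2 C, C \in signed_circuits N & supp C \subset I.
Proof.
rewrite -independent_free => /forallPn[C]; rewrite negb_imply negbK.
by case/andP; exists C.
Qed.

Definition xprod S : polyE E := \prod_(j in S) varE j.

Lemma xprodD I S : S \subset I -> xprod I = xprod (I :\: S) * xprod S.
Proof.
by move=> /setIidPr SI; rewrite /xprod (big_setID S) /= SI mulrC.
Qed.

Lemma xprodD1 S k : k \in S -> xprod S = varE k * xprod (S :\ k).
Proof. by move=> kS; rewrite /xprod (big_setD1 k). Qed.

Lemma sign_unit (s : sign) : s != Zero ->
  (sign_int s)%:MP * (sign_int s)%:MP = 1 :> polyE E.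
Proof. by case: s => //= _; rewrite -mpolyCM. Qed.

(** Multiplying a circuit relation by one of its variables leaves, modulo squares,
    plus or minus the monomial of the circuit. *)
Lemma ideal_dependent I : ~~ free_set N I -> ideal (xprod I).
Proof.
case/dependent_circuit=> C CN CI; rewrite (xprodD CI); apply: idealM.
have := CN; rewrite inE => /and3P[_ C0 _].
have [k kC] : exists k, k \in supp C.
  apply/set0Pn; apply: contraNneq C0 => C0; apply/eqP/ffunP=> e.
  by have /setP/(_ e) := C0; rewrite !inE ffunE => /negbFE/eqP.
have Ck : C k != Zero by rewrite inE in kC.
have -> : xprod (supp C) = (sign_int (C k))%:MP * (varE k * circuit_rel C)
   - (sign_int (C k))%:MP * \sum_(j in supp C | j != k) varE k *
        ((sign_int (C j))%:MP * xprod (supp C :\ j)).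
  rewrite -mulrBr -mulr_sumr -mulrBr /circuit_rel (bigD1 k) //= addrK.
  rewrite -/(xprod _) mulrCA [X in _ * X]mulrA sign_unit // mul1r; exact: xprodD1.
apply: idealD; first by do 2!apply: idealM; exact: ideal_circuit.
apply/idealN/idealM/ideal_sum=> j /andP[jC jk].
rewrite (xprodD1 (S := supp C :\ j) (k := k)); last by rewrite in_setD1 eq_sym jk.
have -> : forall a b c : polyE E, a * (b * (a * c)) = b * c * a ^+ 2.
  by move=> a b c; ring.
exact/idealM/ideal_sq.
Qed.

(** If the support of V minus k is nonfree for all k, each term of the relation is
    in the ideal.  Otherwise the support contains a unique circuit up to sign,
    and V is that circuit or its opposite. *)
Lemma ideal_vector V : V \in vectors N -> ideal (circuit_rel V).
Proof.
move=> VN; have [[k kV fk]|nf] := altP (@exists_inP _ (mem (supp V))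
  (fun k => free_set N (supp V :\ k))); last first.
  apply: ideal_sum => k kV; rewrite -/(xprod _); apply/idealM/ideal_dependent.
  by apply: contraNN nf => fk; apply/exists_inP; exists k.
have Vk : V k != Zero by move: kV; rewrite /= inE.
have V0 : V != sv0 E by apply: contraNneq Vk => ->; rewrite ffunE.
have /in_vectors oV := VN.
have [D DN DV] := dependent_circuit (vector_not_free V0 oV).
have := DN; rewrite inE => /and3P[/in_vectors oD D0 _].
have Dk : D k != Zero.
  apply/negP=> Dk; have /negP := vector_not_free D0 oD; apply.
  by apply: free_sub fk; rewrite subsetD1 DV inE Dk.
have [VD|VD] := eqVneq (V k) (D k).
  by rewrite (vector_unique (om_axioms N) oV oD DV Vk VD fk); apply: ideal_circuit.
have -> : V = svopp D.
  apply: (vector_unique (om_axioms N) oV _ _ Vk) fk.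
  - move=> X XN; apply: (orth_prod (X := D) (Y := svopp X)).
      by move=> e; rewrite !svoppE; case: (D e); case: (X e).
    exact/oD/covectorN.
  - by apply: subset_trans DV; apply/subsetP=> e; rewrite !inE svoppE; case: (D e).
  by rewrite svoppE; move: Vk Dk VD; case: (V k); case: (D k).
suff -> : circuit_rel (svopp D) = - circuit_rel D.
  exact/idealN/ideal_circuit.
have sD : supp (svopp D) = supp D.
  by apply/setP=> e; rewrite !inE svoppE; case: (D e).
rewrite /circuit_rel sD -sumrN; apply: eq_bigr => j _.
rewrite svoppE -mulNr -mpolyCN; congr (_%:MP * _).
by case: (D j).
Qed.

(** The terms of the relation of C that omit an element of W add up to a multiple
    of the relation of W; the other ones are multiples of the monomial of W. *)
Lemma ideal_extend C W : W != sv0 E -> W \in vectors N ->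
  (forall e, W e != Zero -> W e = C e) -> ideal (circuit_rel C).
Proof.
move=> W0 WN WC.
have sWC : supp W \subset supp C.
  by apply/subsetP=> e; rewrite !inE => We; rewrite -WC.
have xW : ideal (xprod (supp W)).
  by apply: ideal_dependent; apply: vector_not_free W0 _; apply/in_vectors.
rewrite /circuit_rel (bigID (mem (supp W))) /=; apply: idealD.
  rewrite (_ : \sum_(_ in _ | _) _ = xprod (supp C :\: supp W) * circuit_rel W).
    exact/idealM/ideal_vector.
  rewrite /circuit_rel mulr_sumr; apply: eq_big => k.
    by rewrite andbC; case kW: (k \in supp W) => //=; rewrite (subsetP sWC).
  case/andP=> _ kW; rewrite -!/(xprod _) mulrCA.
  rewrite WC; last by rewrite inE in kW.
  congr (_ * _); rewrite (xprodD (setSD _ sWC)); congr (xprod _ * _).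
  apply/setP=> e; rewrite !inE; have [->|//] := eqVneq e k.
  by move: kW; rewrite inE => ->; rewrite ?andbF.
apply: ideal_sum => k /andP[kC kW]; rewrite -/(xprod _); apply: idealM.
rewrite (xprodD (I := supp C :\ k) (S := supp W)); first exact: idealM.
by rewrite subsetD1 sWC.
Qed.

End Ideal.

Lemma initial_ideal (E : finType) (M : orientedMatroid E) (F F' : flag M)
    (sub : {subset flag_seq F <= flag_seq F'}) (q : polyE E) :
  cordovil_ideal (initial F) q -> cordovil_ideal (initial F') q.
Proof.
move=> [a [b ->]]; apply: idealD; apply: ideal_sum.
  by move=> e _; apply/idealM/ideal_sq.
move=> C; rewrite inE => /and3P[/in_vectors oC C0 _]; apply: idealM.
have [W [W0 WC oW]] := initial_vector sub C0 oC.
by apply: ideal_extend W0 _ WC; apply/in_vectors.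
Qed.

(** * Chains of topes, moments, and lifting from contractions *)

Section Chains.
Variable E : finType.
Implicit Types (N : {set signvec E}) (X Y Z T U V : signvec E).
Implicit Types (I J D S : {set E}) (d e f g : E) (x y z c : chain E).

Definition pairing (phi : signvec E -> int) x : int := \sum_T x T * phi T.
Definition push (h : signvec E -> signvec E) x : chain E :=
  [ffun V => pairing (fun U => (h U == V)%:R) x].
Definition positive_on S T := [forall e in S, T e == Plus].
Lemma positive_on0 T : positive_on set0 T = true.
Proof. by apply/forall_inP=> e; rewrite inE. Qed.

(** The value of x on the product of the Heaviside functions of S. *)
Definition moment S x := pairing (fun T => (positive_on S T)%:R) x.

(** The group P_p.  Since Heaviside functions are idempotent, squarefree monomials
    detect it (see [dualVG_vg_dual]). *)
Definition vg_dual N p x : Prop :=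
  (forall T, ~~ tope N T -> x T = 0) /\
  (forall S, (#|S| < p)%N -> moment S x = 0).

Lemma chainB x y T : (x - y) T = x T - y T.
Proof. by rewrite ffunE [(- y) T]ffunE. Qed.

Lemma pairingB phi x y : pairing phi (x - y) = pairing phi x - pairing phi y.
Proof.
by rewrite -sumrB; apply: eq_bigr => T _; rewrite chainB mulrBl.
Qed.

Lemma pairing0 phi : pairing phi 0 = 0.
Proof. by apply: big1 => T _; rewrite ffunE mul0r. Qed.

Lemma eq_pairing phi psi x : (forall T, x T != 0 -> phi T = psi T) ->
  pairing phi x = pairing psi x.
Proof.
move=> H; apply: eq_bigr => T _; have [->|/H->//] := eqVneq (x T) 0.
by rewrite !mul0r.
Qed.

Lemma pairing_delta V x : pairing (fun U => (U == V)%:R) x = x V.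
Proof.
rewrite /pairing (bigD1 V) //= eqxx mulr1 big1 ?addr0 // => U /negPf->.
by rewrite mulr0.
Qed.

Lemma pairing_push phi h x : pairing phi (push h x) = pairing (phi \o h) x.
Proof.
rewrite /pairing; under eq_bigr do rewrite ffunE mulr_suml.
rewrite exchange_big /=; apply: eq_bigr => U _.
under eq_bigr do rewrite -mulrA.
rewrite -mulr_sumr; congr (_ * _); rewrite (bigD1 (h U)) //= eqxx mul1r.
by rewrite big1 ?addr0 // => V /negPf; rewrite eq_sym => ->; rewrite mul0r.
Qed.

Lemma push_comp h k x : push h (push k x) = push (h \o k) x.
Proof. by apply/ffunP=> V; rewrite !ffunE pairing_push. Qed.

Lemma pushB h x y : push h (x - y) = push h x - push h y.
Proof. by apply/ffunP=> V; rewrite !ffunE pairingB. Qed.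

Lemma push0 h : push h 0 = 0.
Proof. by apply/ffunP=> V; rewrite !ffunE pairing0. Qed.

Lemma eq_push h k x : (forall U, x U != 0 -> h U = k U) -> push h x = push k x.
Proof.
by move=> H; apply/ffunP=> V; rewrite !ffunE; apply: eq_pairing => U /H->.
Qed.

Lemma push_id x : push id x = x.
Proof. by apply/ffunP=> V; rewrite ffunE pairing_delta. Qed.

Lemma push_basis h U : push h (basis_chain U) = basis_chain (h U).
Proof.
apply/ffunP=> V; rewrite !ffunE /pairing (bigD1 U) //= ffunE eqxx mul1r.
rewrite big1 ?addr0 ?[V == _]eq_sym // => W /negPf WU.
by rewrite ffunE WU mul0r.
Qed.

Lemma push_support (P : pred (signvec E)) h x :
  (forall U, x U != 0 -> P (h U)) -> forall V, ~~ P V -> push h x V = 0.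
Proof.
move=> H V PV; rewrite ffunE; apply: big1 => U _.
have [->|/H PU] := eqVneq (x U) 0; first by rewrite mul0r.
by case: eqP PV => [<-|]; rewrite ?PU ?mulr0.
Qed.

Lemma momentB S x y : moment S (x - y) = moment S x - moment S y.
Proof. exact: pairingB. Qed.

Lemma vg_dualB N p x y : vg_dual N p x -> vg_dual N p y -> vg_dual N p (x - y).
Proof.
move=> [tx mx] [ty my]; split=> [T nT|S Sp].
  by rewrite chainB tx // ty // subr0.
by rewrite momentB mx // my // subr0.
Qed.

Lemma vg_dual0 N p : vg_dual N p 0.
Proof. by split=> [T _|S _]; [rewrite ffunE | exact: pairing0]. Qed.

Lemma vg_dual_tope N p x T : vg_dual N p x -> x T != 0 -> tope N T.
Proof. by move=> [tx _]; apply: contraNT => /tx->. Qed.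

(** A tope U of the contraction of a parallel class D is replaced by the difference
    of the two topes that agree with U off D, and with T or its opposite on D. *)
Definition lift_chain T x :=
  push (fun U => svcomp U T) x - push (fun U => svcomp U (svopp T)) x.

Lemma lift_chain0 T : lift_chain T 0 = 0.
Proof. by rewrite /lift_chain !push0 subr0. Qed.

Lemma lift_chainB T x y : lift_chain T (x - y) = lift_chain T x - lift_chain T y.
Proof.
rewrite /lift_chain !pushB !opprD !opprK addrACA; congr (_ + _); exact: addrC.
Qed.

Section Lift.
Variables (N : {set signvec E}) (oN : covector_axioms N) (d : E) (T : signvec E).
Hypotheses (TN : T \in N) (Td : T d != Zero).

Lemma svcomp_con U e : tope (contraction d N) U ->
  svcomp U T e = if e \in parallel_class N d then T e else U e.
Proof.
move=> /topeP[]; rewrite in_con => /andP[UN Ud] U0; rewrite svcompE inE.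
have [Ue|Ue] := boolP (nonloop (contraction d N) e).
  by rewrite (negPf (U0 _ Ue)) andbF.
rewrite andbT; have [en|el] := boolP (nonloop N e).
  by rewrite (loopE Ue) ?in_con ?UN.
by rewrite (loopE el UN) (loopE el TN).
Qed.

Lemma tope_svcomp U : tope (contraction d N) U -> tope N (svcomp U T).
Proof.
move=> tU; have /topeP[] := tU; rewrite in_con => /andP[UN _] U0.
apply/topeP; split=> [|e ne]; first exact: (covC oN).
rewrite svcomp_con //; case: ifP => [ec|].
  by rewrite (cls_loop oN ec).
by rewrite inE ne /= => /negbFE/U0.
Qed.

(** On the parallel class of d the signs come from T and off it they come from U,
    so being positive on S splits into a condition on T and one on U. *)
Lemma moment_svcomp S x : (forall U, ~~ tope (contraction d N) U -> x U = 0) ->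
  moment S (push (fun U => svcomp U T) x) =
    moment (S :\: parallel_class N d) x * (positive_on (S :&: parallel_class N d) T)%:R.
Proof.
move=> tx; rewrite /moment pairing_push [in RHS]/pairing mulr_suml.
apply: eq_bigr => U _; have [xU|xU] := eqVneq (x U) 0; first by rewrite xU !mul0r.
have tU : tope (contraction d N) U by apply: contraNT xU => /tx->.
rewrite -mulrA -natrM mulnb; congr (_ * (nat_of_bool _)%:R).
apply/forall_inP/andP=> /= [H|[/forall_inP H1 /forall_inP H2] e eS].
  split; apply/forall_inP=> e; rewrite inE => /andP[h1 h2].
    by have := H e h2; rewrite svcomp_con // (negPf h1).
  by have := H e h1; rewrite svcomp_con // h2.
rewrite svcomp_con //; case: ifP => ec; first by apply: H2; rewrite inE eS ec.
by apply: H1; rewrite inE eS ec.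
Qed.
End Lift.

Lemma moment_lift N d T S x : covector_axioms N -> T \in N -> T d != Zero ->
  (forall U, ~~ tope (contraction d N) U -> x U = 0) ->
  moment S (lift_chain T x) = moment (S :\: parallel_class N d) x *
    ((positive_on (S :&: parallel_class N d) T)%:R -
     (positive_on (S :&: parallel_class N d) (svopp T))%:R).
Proof.
move=> oN TN Td tx; rewrite momentB !(moment_svcomp (N := N) (d := d)) // ?mulrBr //.
exact: (covN oN).
Qed.

(** If S misses the parallel class, the two halves of the lift have equal moments.
    Otherwise the moment is a multiple of one at a smaller set. *)
Lemma lift_vg_dual N d T p x : covector_axioms N -> T \in N -> T d != Zero ->
  vg_dual (contraction d N) p x -> vg_dual N p.+1 (lift_chain T x).
Proof.
move=> oN TN Td dx; have [tx mx] := dx.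
have Td' : svopp T d != Zero by rewrite svoppE; case: (T d) Td.
have TN' := covN oN TN.
split=> [V nV|S Sp].
  rewrite chainB.
  rewrite !(push_support (P := tope N)) ?subr0 // => U xU.
    by apply: (tope_svcomp oN TN' Td'); apply: vg_dual_tope dx xU.
  by apply: (tope_svcomp oN TN Td); apply: vg_dual_tope dx xU.
rewrite (moment_lift _ oN TN Td tx).
have [->|[e eSD]] := set_0Vmem (S :&: parallel_class N d);
  first by rewrite !positive_on0 subrr mulr0.
rewrite mx ?mul0r //; rewrite -ltnS; apply: leq_trans Sp.
rewrite ltnS; apply/proper_card/properP; split; first exact: subsetDl.
by move: eSD; rewrite in_setI => /andP[eS eD]; exists e; rewrite // in_setD eD.
Qed.

Definition forget e := svset0 (E := E) [set e].

Lemma forgetE e X f : forget e X f = if f == e then Zero else X f.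
Proof. by rewrite svset0E inE. Qed.

Lemma nonloop_del e N f : nonloop (deletion e N) f = (f != e) && nonloop N f.
Proof.
apply/nonloopP/andP=> [[_ /imsetP[X XN ->]]|[fe /nonloopP[X XN Xf]]].
  rewrite svset0E inE; case: (eqVneq f e) => //= _ Xf; split=> //.
  by apply/nonloopP; exists X.
by exists (forget e X); [exact: imset_f | rewrite forgetE (negPf fe)].
Qed.

Lemma tope_forget e N T : tope N T -> tope (deletion e N) (forget e T).
Proof.
move=> /topeP[TN T0]; apply/topeP; split; first exact: imset_f.
by move=> f; rewrite nonloop_del forgetE => /andP[/negPf-> /T0].
Qed.

Lemma forget_vg_dual e N p x :
  vg_dual N p x -> vg_dual (deletion e N) p (push (forget e) x).
Proof.
move=> dx; split=> [V nV|S Sp].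
  by apply: push_support nV => U /(vg_dual_tope dx); apply: tope_forget.
rewrite /moment pairing_push.
have [eS|eS] := boolP (e \in S).
  apply: big1 => T _ /=; rewrite (_ : positive_on _ _ = false) ?mulr0 //.
  by apply/negbTE/forall_inPn; exists e; rewrite // forgetE eqxx.
rewrite -[RHS](dx.2 S Sp); apply: eq_bigr => T _ /=.
congr (_ * (nat_of_bool _)%:R); apply: eq_forallb_in => f fS.
by have /negPf fe : f != e; [apply: contraNneq eS => <- | rewrite forgetE fe].
Qed.

Lemma con_del d e N : d != e ->
  contraction d (deletion e N) = deletion e (contraction d N).
Proof.
move=> de; apply/setP=> X; rewrite in_con.
apply/andP/imsetP=> [[/imsetP[Y YN ->]]|[Y + ->]].
  by rewrite svset0E inE (negPf de) => Yd; exists Y; rewrite ?in_con ?YN.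
by rewrite in_con => /andP[YN Yd]; rewrite svset0E inE (negPf de) imset_f.
Qed.

Lemma forget_svcomp e U T : forget e (svcomp U T) = svcomp (forget e U) (forget e T).
Proof. by apply/ffunP=> f; rewrite !(forgetE, svcompE); case: (f == e). Qed.

Lemma push_forget_lift e T x :
  push (forget e) (lift_chain T x) = lift_chain (forget e T) (push (forget e) x).
Proof.
rewrite /lift_chain pushB !push_comp; congr (_ - _); apply: eq_push => U _ /=.
  exact: forget_svcomp.
rewrite forget_svcomp; congr svcomp.
by apply/ffunP=> f; rewrite !(forgetE, svoppE); case: ifP.
Qed.

Lemma tope_forget_onto e N U : covector_axioms N -> tope (deletion e N) U ->
  exists2 T, tope N T & forget e T = U.
Proof.
move=> oN /topeP[/imsetP[X XN ->] U0]; have [T /topeP[TN T0]] := tope_exists oN.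
have h f : f != e -> nonloop N f -> X f != Zero.
  move=> fe nf; have := U0 f; rewrite nonloop_del fe nf svset0E inE (negPf fe).
  exact.
exists (svcomp X T).
  apply/topeP; split=> [|f nf]; first exact: (covC oN).
  by rewrite svcompE; case: ifP => [_|->//]; exact: T0.
apply/ffunP=> f; rewrite forgetE svset0E inE svcompE; case: (eqVneq f e) => // fe.
have [nf|lf] := boolP (nonloop N f); first by rewrite (negPf (h f fe nf)).
by rewrite !(loopE lf) // eqxx.
Qed.

(** Spanning is expressed below through all subgroups that contain the generators,
    which dispenses with explicit linear combinations. *)
Definition closed_sub (K : chain E -> Prop) :=
  K 0 /\ forall x y, K x -> K y -> K (x - y).

Definition del_onto p := forall N e x, covector_axioms N ->
  vg_dual (deletion e N) p x ->
  exists2 y, vg_dual N p y & push (forget e) y = x.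

Definition lift_spans p N := forall x (K : chain E -> Prop), vg_dual N p.+1 x ->
  closed_sub K ->
  (forall d T c, T \in N -> T d != Zero -> vg_dual (contraction d N) p c ->
     K (lift_chain T c)) ->
  K x.

Lemma del_onto0 : del_onto 0.
Proof.
move=> N e x oN [tx _].
pose h U := odflt U [pick T | tope N T && (forget e T == U)].
have hP U : x U != 0 -> tope N (h U) /\ forget e (h U) = U.
  move=> xU; have [T tT TU] : exists2 T, tope N T & forget e T = U.
    by apply: tope_forget_onto oN _; apply: contraNT xU => /tx->.
  rewrite /h; case: pickP => [V /andP[? /eqP]//|/(_ T)].
  by rewrite tT TU eqxx.
exists (push h x); last first.
  rewrite push_comp -[RHS]push_id; apply: eq_push => U xU /=.
  by have [] := hP U xU.
by split=> // V; apply: push_support => U /hP[].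
Qed.

(** A lift for the deletion is the image of a lift, because forgetting e commutes
    with lifting and with contraction. *)
Lemma lift_del_onto p e N : covector_axioms N -> del_onto p ->
  lift_spans p (deletion e N) -> forall x (K : chain E -> Prop),
  vg_dual (deletion e N) p.+1 x -> closed_sub K ->
  (forall d T c, T \in N -> T d != Zero -> vg_dual (contraction d N) p c ->
     K (lift_chain T c)) ->
  exists y, [/\ K y, vg_dual N p.+1 y & push (forget e) y = x].
Proof.
move=> oN Ap Bp x K dx [K0 KB] Kl.
apply: (Bp x (fun x =>
  exists y, [/\ K y, vg_dual N p.+1 y & push (forget e) y = x])) => //.
  split; first by exists 0; split; [|exact: vg_dual0|exact: push0].
  move=> _ _ [y [Ky dy <-]] [z [Kz dz <-]]; exists (y - z).
  by split; [exact: KB|exact: vg_dualB|exact: pushB].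
move=> d _ c /imsetP[T TN ->]; rewrite svset0E inE; case: (eqVneq d e) => //= de Td.
rewrite con_del // => dc.
have [c' dc' <-] := Ap (contraction d N) e c (con_axioms d oN) dc.
exists (lift_chain T c'); split; [exact: Kl dc'| |exact: push_forget_lift].
exact: (lift_vg_dual oN TN Td).
Qed.

Definition set_sign s e U : signvec E := [ffun f => if f == e then s else U f].

Lemma set_signE s e U f : set_sign s e U f = if f == e then s else U f.
Proof. by rewrite ffunE. Qed.

Lemma set_sign_forget s e U V : U e = Zero -> V e = s ->
  (set_sign s e U == V) = (U == forget e V).
Proof.
move=> Ue Ve; apply/eqP/eqP=> [<-|->]; apply/ffunP=> f;
  by rewrite !(forgetE, set_signE) //; case: eqP => // ->.
Qed.

(** A tope T in the support of x must cancel against the only other tope that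
    becomes equal to it when e is forgotten, so T and its flip at e are both
    topes.  Eliminating e between them shows that e is parallel to no other
    element and that T with e zeroed is a tope of the contraction; x is then
    recovered from its values at topes positive at e. *)
Lemma forget_kernel p e N x : covector_axioms N -> vg_dual N p.+1 x ->
  nonloop N e -> push (forget e) x = 0 -> x != 0 ->
  exists T c,
    [/\ T \in N, T e != Zero, vg_dual (contraction e N) p c & x = lift_chain T c].
Proof.
move=> oN dx ne px x0.
have x_e V : x V != 0 -> V e != Zero by move=> /(vg_dual_tope dx)/topeP[_]; apply.
have flip U : x (set_sign Plus e U) = - x (set_sign Minus e U).
  apply/eqP; rewrite -addr_eq0 -(pairing_delta (set_sign Plus e U)).
  rewrite -(pairing_delta (set_sign Minus e U)) -big_split /=; apply/eqP.
  have /ffunP/(_ (forget e U)) := px; rewrite !ffunE; apply: etrans.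
  apply: eq_bigr => V _; rewrite -mulrDr.
  have [->|/x_e Ve] := eqVneq (x V) 0; first by rewrite !mul0r.
  congr (_ * _).
  have VU s : (V == set_sign s e U) = (V e == s) && (forget e V == forget e U).
    apply/eqP/andP=> [->|[/eqP Ve' /eqP/ffunP VU]].
      split; first by rewrite set_signE eqxx.
      by apply/eqP/ffunP=> f; rewrite !(forgetE, set_signE); case: (f == e).
    apply/ffunP=> f; have := VU f; rewrite !(forgetE, set_signE).
    by case: eqP => // ->.
  by rewrite !VU; case: (V e) Ve => //=; rewrite ?addr0 ?add0r.
have forgetN U : x (set_sign Plus e U) != 0 -> forget e U \in N.
  move=> xU; have /(vg_dual_tope dx)/topeP[UpN _] := xU.
  have /(vg_dual_tope dx)/topeP[UmN _] : x (set_sign Minus e U) != 0.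
    by rewrite -oppr_eq0 -flip.
  have [|Z [ZN Ze Zf]] := covE oN UpN UmN (e := e).
    by rewrite inE !set_signE eqxx.
  suff <- : Z = forget e U by [].
  apply/ffunP=> f; rewrite forgetE; case: (eqVneq f e) => [->//|fe].
  have sf s : set_sign s e U f = U f by rewrite set_signE (negPf fe).
  by rewrite Zf ?inE ?svcompE !sf; case: (U f).
pose c : chain E :=
  [ffun U : signvec E => if U e == Zero then x (set_sign Plus e U) else 0].
have cP U : c U != 0 -> U e = Zero /\ x (set_sign Plus e U) != 0.
  by rewrite ffunE; case: (U e =P Zero).
have [T xT Te] : exists2 T, x T != 0 & T e = Plus.
  have [V xV] : exists V, x V != 0.
    apply/existsP; apply: contraNT x0 => /existsPn H; apply/eqP/ffunP=> V.
    by rewrite ffunE; have := H V; rewrite negbK => /eqP.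
  have VE s : V e = s -> V = set_sign s e V.
    by move=> Ve; apply/ffunP=> f; rewrite set_signE; case: eqP => // ->.
  exists (set_sign Plus e V); last by rewrite set_signE eqxx.
  have := x_e _ xV; case Ve: (V e) => // _; first by rewrite -VE.
  by rewrite flip oppr_eq0 -VE.
have /(vg_dual_tope dx)/topeP[TN T0] := xT.
have TP : set_sign Plus e T = T.
  by apply/ffunP=> f; rewrite set_signE; case: eqP => // ->.
have clse : parallel_class N e = [set e].
  apply/setP=> f; rewrite !inE.
  have [->|fe] := eqVneq f e; first by rewrite ne con_loop.
  apply/negP=> /andP[nf /negP]; apply.
  apply: (sv_sub_nonloop (X := forget e T)); last by rewrite forgetE (negPf fe) T0.
  by rewrite in_con forgetE eqxx forgetN // TP.
have tc U : ~~ tope (contraction e N) U -> c U = 0.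
  move=> nU; apply/eqP; apply: contraNT nU => /cP[Ue xU].
  have /(vg_dual_tope dx)/topeP[_ U0] := xU.
  have UE : forget e U = U by apply/ffunP=> f; rewrite forgetE; case: eqP => // ->.
  apply/topeP; rewrite in_con Ue -UE forgetN ?UE //; split=> // f nf.
  have := U0 f (nonloop_con nf); rewrite set_signE; case: (f =P e) => // fe.
  by move: nf; rewrite fe (negPf (con_loop _ _)).
have compE s V : V \in N -> V e = s -> s != Zero ->
    push (fun U => svcomp U V) c = push (set_sign s e) c.
  move=> VN Ve s0; apply: eq_push => U /cP[Ue xU]; apply/ffunP=> f.
  have /(vg_dual_tope dx)/topeP[_ U0] := xU.
  rewrite svcompE set_signE; case: (eqVneq f e) => [->|fe]; first by rewrite Ue eqxx.
  case: eqP => // Uf; rewrite Uf; apply: (loopE _ VN); apply/negP=> /U0.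
  by rewrite set_signE (negPf fe) Uf.
have xl : x = lift_chain T c.
  rewrite /lift_chain (compE Plus) // (compE Minus) ?(covN oN) ?svoppE ?Te //.
  have ne0 s V : V e <> s -> pairing (fun U => (set_sign s e U == V)%:R) c = 0.
    move=> Ve; apply: big1 => U _; rewrite (_ : _ == _ = false) ?mulr0 //.
    by apply/eqP=> UV; apply: Ve; rewrite -UV set_signE eqxx.
  have eq0 s V : V e = s -> pairing (fun U => (set_sign s e U == V)%:R) c =
      x (set_sign Plus e V).
    move=> Ve; rewrite (@eq_pairing _ (fun U => (U == forget e V)%:R)).
      rewrite pairing_delta ffunE forgetE eqxx /=; congr (x _).
      by apply/ffunP=> f; rewrite !(set_signE, forgetE); case: eqP.
    by move=> U /cP[Ue _]; rewrite set_sign_forget.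
  apply/ffunP=> V; rewrite chainB !ffunE.
  case Ve: (V e).
  - rewrite !ne0 ?Ve // subr0; apply/eqP; apply: contraT => /x_e.
    by rewrite Ve.
  - rewrite (ne0 Minus) ?Ve // eq0 ?Ve // subr0; congr (x _).
    by apply/ffunP=> f; rewrite set_signE; case: eqP => // ->.
  - rewrite (ne0 Plus) ?Ve // eq0 ?Ve // sub0r flip opprK; congr (x _).
    by apply/ffunP=> f; rewrite set_signE; case: eqP => // ->.
exists T, c; split=> //; first by rewrite Te.
split=> // S Sp; have [eS|eS] := boolP (e \in S).
  apply: big1 => U _; have [->|/cP[Ue _]] := eqVneq (c U) 0; first by rewrite mul0r.
  rewrite (_ : positive_on _ _ = false) ?mulr0 //.
  by apply/negbTE/forall_inPn; exists e; rewrite ?Ue.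
have [_ /(_ (e |: S))] := dx; rewrite cardsU1 eS ltnS => /(_ Sp).
rewrite xl (moment_lift _ oN TN _ tc) ?Te // clse.
rewrite setU1K //.
have -> : (e |: S) :&: [set e] = [set e].
  by apply/setIidPr; rewrite sub1set !inE eqxx.
have pos1 V : positive_on [set e] V = (V e == Plus).
  apply/forall_inP/idP=> [H|Ve f]; first by apply: H; rewrite inE.
  by rewrite inE => /eqP ->.
by rewrite !pos1 svoppE Te eqxx subr0 mulr1.
Qed.

(** Induction on the number of nonloops.  After subtracting a combination of lifts
    with the same image in the deletion of e, the chain is killed by forgetting
    e, hence a lift. *)
Lemma lift_spansP p N : covector_axioms N -> del_onto p -> lift_spans p N.
Proof.
move=> oN Ap; have [n] := ubnP #|[set e | nonloop N e]|.
elim: n N oN => // n IHn N oN; rewrite ltnS => le_n x K dx cK Kl.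
have [|[e]] := set_0Vmem [set e | nonloop N e].
  (* Without nonloops x is a multiple of one sign vector, namely by its moment
     at the empty set. *)
  move=> /setP noN; suff -> : x = 0 by case: cK.
  apply/ffunP=> T; have [_ /(_ set0)] := dx; rewrite cards0 => /(_ isT) mx.
  have Tz U : x U != 0 -> U = sv0 E.
    move=> /(vg_dual_tope dx)/topeP[UN _]; apply/ffunP=> e.
    by rewrite ffunE; apply: loopE UN; have := noN e; rewrite !inE => ->.
  have xT U : U != sv0 E -> x U = 0.
    by move=> U0; apply/eqP; apply: contraNT U0 => /Tz ->.
  rewrite ffunE; have [->|/xT//] := eqVneq T (sv0 E).
  move: mx; rewrite /moment /pairing (bigD1 (sv0 E)) //= big1.
    by rewrite positive_on0 mulr1 addr0.
  by move=> U /xT ->; rewrite mul0r.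
rewrite inE => ne.
have Bd : lift_spans p (deletion e N).
  apply: IHn; first exact: del_axioms.
  apply: leq_trans le_n; apply/proper_card/properP; split.
    by apply/subsetP=> f; rewrite !inE nonloop_del => /andP[].
  by exists e; rewrite ?inE // nonloop_del eqxx.
have [y [Ky dy xy]] := lift_del_onto oN Ap Bd (forget_vg_dual e dx) cK Kl.
suff Kxy : K (x - y).
  have -> : x = (x - y) - (0 - y) by rewrite sub0r opprK subrK.
  by apply: cK.2 => //; apply: cK.2 => //; case: cK.
have [->|xy0] := eqVneq (x - y) 0; first by case: cK.
have [|T [c [TN Te dc ->]]] := forget_kernel oN (vg_dualB dx dy) ne _ xy0.
  by rewrite pushB xy subrr.
exact: Kl dc.
Qed.

Lemma del_ontoP p : del_onto p.
Proof.
elim: p => [|p IHp]; first exact: del_onto0.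
move=> N e x oN dx.
have Bd := lift_spansP (del_axioms e oN) IHp.
have [] := @lift_del_onto p e N oN IHp Bd x (fun=> True) dx => //.
by move=> y [_ dy yx]; exists y.
Qed.
End Chains.

(** * Prefix chains span, and prefixes extend to complete flags *)

Section Prefix.
Variable E : finType.
Implicit Types (N : {set signvec E}) (X Y Z T U V : signvec E).
Implicit Types (I J D S : {set E}) (d e f g : E) (x y z c : chain E).
Implicit Types (s : seq {set E}).

Definition flip D T : signvec E := [ffun e => if e \in D then sopp (T e) else T e].

Lemma flipE D T e : flip D T e = if e \in D then sopp (T e) else T e.
Proof. by rewrite ffunE. Qed.

Fixpoint block_chain s T : chain E :=
  if s is D :: s' then block_chain s' T - block_chain s' (flip D T)
  else basis_chain T.

(** An initial segment of a complete flag, with T in its tope set.  It is recorded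
    by its blocks, so that it grows by contracting, one after the other, parallel
    classes D for which T with D zeroed is still a covector. *)
Fixpoint block_prefix N s T : Prop :=
  if s is D :: s' then
    exists d, [/\ nonloop N d, D = parallel_class N d, T \in N, T d != Zero
                & block_prefix (contraction d N) s' (svset0 D T)]
  else tope N T.

Lemma push_block_chain s U T : (forall D, D \in s -> D \subset supp U) ->
  push (fun V => svcomp V T) (block_chain s U) = block_chain s (svcomp U T).
Proof.
elim: s U => [|D s IHs] U DU /=; first by rewrite push_basis.
rewrite pushB !IHs.
- congr (_ - block_chain s _); apply/ffunP=> e.
  rewrite !(svcompE, flipE); case eD: (e \in D) => //.
  have /subsetP/(_ e eD) := DU D (mem_head _ _); rewrite inE.
  by case: (U e).
- move=> D' D's; have /subsetP DU' := DU D' (mem_behead (s := D :: s) D's).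
  apply/subsetP=> e /DU'; rewrite !inE flipE.
  by case: ifP => // _; case: (U e).
- by move=> D' D's; apply: DU; rewrite inE D's orbT.
Qed.

Lemma tope_decomp N d T : covector_axioms N -> T \in N -> T d != Zero ->
  tope (contraction d N) (svset0 (parallel_class N d) T) -> tope N T.
Proof.
move=> oN TN Td /topeP[_ T0]; apply/topeP; split=> // e ne.
have [ec|ec] := boolP (e \in parallel_class N d); first by rewrite (cls_loop oN ec).
have := T0 e; rewrite svset0E (negPf ec); apply.
by move: ec; rewrite inE ne /= negbK.
Qed.

Lemma prefix_tope N s T : covector_axioms N -> block_prefix N s T -> tope N T.
Proof.
elim: s N T => [|D s IHs] N T oN //= [d [_ -> TN Td /(IHs _ _ (con_axioms d oN)) tT]].
exact: (tope_decomp oN TN Td).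
Qed.

Lemma prefix_supp N s T : covector_axioms N -> block_prefix N s T ->
  forall D, D \in s -> D \subset supp T.
Proof.
elim: s N T => [|D s IHs] N T oN //= [d [nd -> TN Td pT]] D'.
rewrite inE => /predU1P[->|/(IHs _ _ (con_axioms d oN) pT)].
  by apply/subsetP=> e ec; rewrite inE (cls_loop oN ec).
move/subsetP=> h; apply/subsetP=> e /h; rewrite !inE svset0E.
by case: ifP.
Qed.

Lemma lift_block_chain N d T s U : covector_axioms N -> T \in N -> T d != Zero ->
  block_prefix (contraction d N) s U ->
  lift_chain T (block_chain s U) = block_chain (parallel_class N d :: s) (svcomp U T) /\
  block_prefix N (parallel_class N d :: s) (svcomp U T).
Proof.
move=> oN TN Td pU; have oNd := con_axioms d oN.
have tU := prefix_tope oNd pU; have sU := prefix_supp oNd pU.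
have compE V : V \in N ->
    svcomp U V = [ffun e => if e \in parallel_class N d then V e else U e].
  by move=> VN; apply/ffunP=> e; rewrite (svcomp_con VN e tU) ffunE.
have nd := sv_sub_nonloop TN Td.
have dd : d \in parallel_class N d by rewrite inE nd con_loop.
split.
  rewrite /lift_chain !push_block_chain //=; congr (_ - block_chain s _).
  rewrite !compE ?(covN oN) //; apply/ffunP=> e; rewrite !ffunE.
  by case: (e \in _).
exists d; split=> //.
- by rewrite (covC oN) //; have /topeP[] := tU; rewrite in_con => /andP[].
- by rewrite compE // ffunE dd.
suff -> : svset0 (parallel_class N d) (svcomp U T) = U by [].
apply/ffunP=> e; rewrite svset0E compE // ffunE; case: ifP => [ec|->//].
apply/esym/loopE; last by have /topeP[UN _] := tU; exact: UN.
by move: ec; rewrite inE => /andP[].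
Qed.

Section Closed.
Variable K : chain E -> Prop.
Hypothesis cK : closed_sub K.

Lemma closed_add x y : K x -> K y -> K (x + y).
Proof.
move=> Kx Ky; have -> : x + y = x - (0 - y) by rewrite sub0r opprK.
by apply: cK.2 => //; apply: cK.2 => //; case: cK.
Qed.

Lemma closed_mulz x (n : int) : K x -> K (x *~ n).
Proof.
have nat_case y m : K y -> K (y *+ m).
  move=> Ky; elim: m => [|m IHm]; first by rewrite mulr0n; case: cK.
  by rewrite mulrS; apply: closed_add.
move=> Kx; case: n => n; first exact: nat_case.
rewrite NegzE mulrNz -sub0r; apply: cK.2; first by case: cK.
exact: (nat_case x n.+1).
Qed.

Lemma closed_sum (I : Type) (r : seq I) (P : pred I) (F : I -> chain E) :
  (forall i, P i -> K (F i)) -> K (\sum_(i <- r | P i) F i).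
Proof. by move=> H; apply: big_ind => //; [case: cK|exact: closed_add]. Qed.
End Closed.

Lemma prefix_span p N : covector_axioms N -> forall x (K : chain E -> Prop),
  vg_dual N p x -> closed_sub K ->
  (forall s T, size s = p -> block_prefix N s T -> K (block_chain s T)) -> K x.
Proof.
elim: p N => [|p IHp] N oN x K dx cK Kg.
  have -> : x = \sum_(T | tope N T) basis_chain T *~ x T.
    apply/ffunP=> V; rewrite sum_ffunE.
    under eq_bigr do rewrite ffunMzE ffunE.
    have [tV|nV] := boolP (tope N V).
      rewrite (bigD1 V) //= eqxx intz big1 ?addr0 // => U /andP[_ /negPf].
      by rewrite eq_sym => ->; rewrite mul0rz.
    rewrite (dx.1 V nV) big1 // => U tU; case: eqP => [VU|]; last by rewrite mul0rz.
    by rewrite VU tU in nV.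
  apply: closed_sum => // T tT; apply: closed_mulz => //.
  exact: (Kg [::]).
apply: (lift_spansP oN (@del_ontoP _ p) dx cK) => d T c TN Td dc.
apply: (IHp (contraction d N) (con_axioms d oN) c (fun c => K (lift_chain T c)) dc).
  split; first by rewrite lift_chain0; case: cK.
  by move=> y z Ky Kz; rewrite lift_chainB; apply: cK.2.
move=> s U sp pU; have [-> pUT] := lift_block_chain oN TN Td pU.
by apply: Kg => //=; rewrite sp.
Qed.

Lemma free_set0 N : covector_axioms N -> free_set N set0.
Proof.
move=> oN; apply/free_setP=> S _; exists (sv0 E); first exact: cov0.
by move=> e; rewrite inE.
Qed.

Lemma free_set_nonloop N I e : free_set N I -> e \in I -> nonloop N e.
Proof.
move=> /free_setP fI eI; have [|X XN XI] := fI [ffun=> Plus].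
  by move=> f _; rewrite ffunE.
by apply/nonloopP; exists X; rewrite // XI // ffunE.
Qed.

(** A maximal proper face Y of T has the required form.  A covector that vanishes
    at d but not on all of the zero set of Y in T could be moved towards T by
    eliminations that preserve these features, ending strictly between Y and T. *)
Lemma facet N T e0 : covector_axioms N -> tope N T -> nonloop N e0 ->
  exists2 d, nonloop N d & svset0 (parallel_class N d) T \in N.
Proof.
move=> oN /topeP[TN T0] ne0.
pose face Y := [&& Y \in N, svle Y T & Y != T].
have T0T : face (sv0 E).
  rewrite /face (cov0 oN) /=; apply/andP; split.
    by apply/forallP=> e; rewrite ffunE eqxx.
  by apply: contraTneq (T0 _ ne0) => <-; rewrite ffunE eqxx.
have [Y /and3P[YN /forallP YT neY] Ymax] := arg_maxnP (fun Y => #|supp Y|) T0T.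
have YTe e : Y e != Zero -> Y e = T e.
  by move=> Ye; have := YT e; rewrite (negPf Ye) => /eqP.
have [d /andP[Yd Td]] : exists d, (Y d == Zero) && (T d != Zero).
  apply/existsP; apply: contraNT neY => /existsPn H; apply/eqP/ffunP=> e.
  have := H e; case: (Y e =P Zero) => [-> /=|/eqP/YTe//].
  by rewrite negbK => /eqP.
have nd := sv_sub_nonloop TN Td.
(* Induction on the separation from T: an elimination towards T keeps X above Y
   and creates a zero at k, until X lies strictly between Y and T, against the
   choice of Y. *)
have key : forall X, X \in N -> (forall e, Y e != Zero -> X e = Y e) ->
    (exists g, [/\ Y g = Zero, T g != Zero & X g = Zero]) ->
    forall h, X h != Zero -> Y h != Zero.
  move=> X; have [n] := ubnP #|sep X T|; elim: n X => // n IHn X.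
  rewrite ltnS => le_n XN XY [g [Yg Tg Xg]] h Xh.
  apply/negP=> Yh.
  have [sep0|[k kS]] := set_0Vmem (sep X T).
    have XTe e : X e != Zero -> X e = T e.
      move=> Xe; have Te := T0 e (sv_sub_nonloop XN Xe).
      have /setP/(_ e) := sep0; rewrite !inE Xe /=.
      by move: Xe Te; case: (X e); case: (T e).
    have fX : face X.
      rewrite /face XN /=; apply/andP; split.
        by apply/forallP=> e; case: (X e =P Zero) => //= /eqP/XTe ->.
      by apply: contraNneq Tg => <-; rewrite Xg.
    have := Ymax X fX; apply/negP; rewrite -ltnNge.
    apply/proper_card/properP; split.
      by apply/subsetP=> e; rewrite !inE => Ye; rewrite XY.
    by exists h; rewrite !inE ?Yh.
  have [Z [ZN Zk Zf]] := covE oN XN TN kS.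
  have Yk : Y k = Zero.
    apply/eqP; apply: contraTT kS => Yk; rewrite inE XY // YTe //.
    by rewrite -YTe //; case: (Y k) Yk.
  have Tk : T k != Zero by move: kS; rewrite inE; case: (X k); case: (T k).
  have gS : g \notin sep X T by rewrite inE Xg.
  have Zg : Z g = T g by rewrite Zf // svcompE Xg.
  have : Y g != Zero; last by rewrite Yg.
  apply: (IHn Z) => //.
  - apply: leq_trans le_n; apply/proper_card/properP; split.
      apply/subsetP=> e; apply: contraLR => eS.
      rewrite inE Zf // svcompE; move: eS; rewrite inE.
      by case: (X e); case: (T e).
    by exists k; rewrite // inE Zk.
  - move=> e Ye; rewrite Zf ?svcompE ?XY ?(negPf Ye) //.
    by rewrite inE XY // YTe //; case: (T e).
  - by exists k.
  - by rewrite Zg.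
exists d => //; suff -> : svset0 (parallel_class N d) T = Y by [].
apply/ffunP=> e; rewrite svset0E inE.
have [ne|le] /= := boolP (nonloop N e); last first.
  by rewrite (loopE le TN) (loopE le YN).
have [/nonloopP[X]|lc] /= := boolP (nonloop (contraction d N) e); last first.
  by rewrite (loopE lc) // in_con YN Yd.
rewrite in_con => /andP[XN /eqP Xd] Xe; apply/esym/YTe.
apply: (key (svcomp Y X)).
- exact: (covC oN).
- by move=> f Yf; rewrite svcompE (negPf Yf).
- by exists d; split; [exact/eqP| |rewrite svcompE Yd].
- by rewrite svcompE; case: ifP => // /negbT.
Qed.

Lemma tope_truncate N d T : covector_axioms N -> tope N T ->
  svset0 (parallel_class N d) T \in N -> nonloop N d ->
  tope (contraction d N) (svset0 (parallel_class N d) T).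
Proof.
move=> oN /topeP[TN T0] cN nd; apply/topeP; split.
  by rewrite in_con cN svset0E inE nd con_loop.
move=> e ne; rewrite svset0E inE ne andbF; exact/T0/(nonloop_con ne).
Qed.

Lemma card_nonloop_con N d : nonloop N d ->
  (#|[set e | nonloop (contraction d N) e]| < #|[set e | nonloop N e]|)%N.
Proof.
move=> nd; apply/proper_card/properP; split.
  by apply/subsetP=> e; rewrite !inE => /nonloop_con.
by exists d; rewrite inE // con_loop.
Qed.

Lemma prefix_full N T : covector_axioms N -> tope N T ->
  exists s, block_prefix N s T /\ forall e, nonloop N e -> exists2 D, D \in s & e \in D.
Proof.
have [n] := ubnP #|[set e | nonloop N e]|; elim: n N T => // n IHn N T.
rewrite ltnS => le_n oN tT.
have [noN|[e0]] := set_0Vmem [set e | nonloop N e].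
  by exists [::]; split=> // e ne; have /setP/(_ e) := noN; rewrite !inE ne.
rewrite inE => /(facet oN tT) [d nd cN].
have [|s [ps cov]] := IHn _ _ _ (con_axioms d oN) (tope_truncate oN tT cN nd).
  exact: leq_trans (card_nonloop_con nd) le_n.
have /topeP[TN T0] := tT.
exists (parallel_class N d :: s); split; first by exists d; split=> //; apply: T0.
move=> e ne; have [lc|nc] := boolP (e \in parallel_class N d).
  by exists (parallel_class N d); rewrite ?mem_head.
have [|D Ds eD] := cov e; last by exists D; rewrite // inE Ds orbT.
by move: nc; rewrite inE ne negbK.
Qed.

Lemma prefix_extend N s T : covector_axioms N -> block_prefix N s T ->
  exists s', block_prefix N (s ++ s') T /\
    forall e, nonloop N e -> exists2 D, D \in s ++ s' & e \in D.
Proof.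
elim: s N T => [|D s IHs] N T oN /= => [tT|[d [nd DE TN Td pT]]].
  by have [s [ps cov]] := prefix_full oN tT; exists s.
have [s' [ps' cov]] := IHs _ _ (con_axioms d oN) pT.
exists s'; split; first by exists d.
move=> e ne; have [lc|nc] := boolP (e \in D).
  by exists D; rewrite ?mem_head.
have [|D' Ds eD] := cov e; last by exists D'; rewrite // inE Ds orbT.
by move: nc; rewrite DE inE ne negbK.
Qed.

Definition union_blocks s : {set E} := \bigcup_(D <- s) D.

Lemma union_cons D s : union_blocks (D :: s) = D :|: union_blocks s.
Proof. by rewrite /union_blocks big_cons. Qed.

Lemma prefix_truncate N s T i : covector_axioms N -> block_prefix N s T ->
  svset0 (union_blocks (take i s)) T \in N.
Proof.
elim: s N T i => [|D s IHs] N T [|i] oN /=.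
- move=> /topeP[TN _]; suff -> : svset0 (union_blocks [::]) T = T by [].
  by apply/ffunP=> e; rewrite svset0E /union_blocks big_nil inE.
- move=> /topeP[TN _]; suff -> : svset0 (union_blocks [::]) T = T by [].
  by apply/ffunP=> e; rewrite svset0E /union_blocks big_nil inE.
- move=> [d [_ _ TN _ _]]; suff -> : svset0 (union_blocks [::]) T = T by [].
  by apply/ffunP=> e; rewrite svset0E /union_blocks big_nil inE.
move=> [d [nd -> TN Td pT]].
have := IHs _ _ i (con_axioms d oN) pT; rewrite in_con => /andP[+ _].
congr (_ \in N); apply/ffunP=> e; rewrite !svset0E union_cons in_setU.
by case: (e \in union_blocks _); case: (e \in parallel_class N d).
Qed.

Lemma prefix_nonloop N s T : covector_axioms N -> block_prefix N s T ->
  forall D, D \in s -> D != set0 /\ forall e, e \in D -> nonloop N e.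
Proof.
elim: s N T => [|D s IHs] N T oN //= [d [nd -> TN Td pT]] D'.
rewrite inE => /predU1P[->|/(IHs _ _ (con_axioms d oN) pT) [D0 nD]].
  split; last by move=> e; rewrite inE => /andP[].
  by apply/set0Pn; exists d; rewrite inE nd con_loop.
by split=> // e /nD /nonloop_con.
Qed.

Lemma prefix_disjoint N s T : covector_axioms N -> block_prefix N s T ->
  pairwise (fun D D' : {set E} => [disjoint D & D']) s.
Proof.
elim: s N T => [|D s IHs] N T oN //= [d [nd -> TN Td pT]].
rewrite (IHs _ _ (con_axioms d oN) pT) andbT; apply/allP=> D' D's.
have [_ nD] := prefix_nonloop (con_axioms d oN) pT D's.
by apply/pred0P=> e /=; apply/andP=> -[+ /nD ne]; rewrite inE ne andbF.
Qed.

Lemma free_set_con N d I : covector_axioms N -> nonloop N d ->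
  free_set (contraction d N) I -> free_set N (d |: I).
Proof.
move=> oN nd /free_setP fI; apply/free_setP=> S S0.
have [e eI|X] := fI S; first by apply: S0; rewrite inE eI orbT.
rewrite in_con => /andP[XN /eqP Xd] XS.
have [Y YN Yd] : exists2 Y, Y \in N & Y d = S d.
  have /nonloopP[Y YN Yd] := nd; have Sd : S d != Zero by apply: S0; rewrite !inE eqxx.
  have [YS|ne] := eqVneq (Y d) (S d); first by exists Y.
  exists (svopp Y); first exact: (covN oN).
  by rewrite svoppE; move: Yd Sd ne; case: (Y d); case: (S d).
exists (svcomp X Y) => [|e]; first exact: (covC oN).
rewrite in_setU1 svcompE => /predU1P[->|eI]; first by rewrite Xd eqxx.
by rewrite XS // (negPf (S0 e _)) // !inE eI orbT.
Qed.

Lemma prefix_free N s T i :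
  covector_axioms N -> block_prefix N s T -> (i <= size s)%N ->
  exists I, [/\ free_set N I, I \subset union_blocks (take i s) & #|I| = i].
Proof.
elim: s N T i => [|D s IHs] N T [|i] oN //=.
- by move=> _ _; exists set0; rewrite sub0set cards0; split=> //; apply: free_set0.
- by move=> _ _; exists set0; rewrite sub0set cards0; split=> //; apply: free_set0.
move=> [d [nd -> TN Td pT]]; rewrite ltnS => /(IHs _ _ i (con_axioms d oN) pT).
case=> I [fI sI cI]; exists (d |: I); split; first exact: free_set_con.
  rewrite union_cons setUSS // sub1set inE nd con_loop //.
rewrite cardsU1 cI; suff -> : d \notin I by [].
by apply/negP=> /(free_set_nonloop fI); rewrite (negPf (con_loop _ _)).
Qed.

Lemma free_set_extend N J f X : covector_axioms N -> free_set N J ->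
  X \in N -> X f != Zero -> (forall e, e \in J -> X e = Zero) ->
  free_set N (f |: J).
Proof.
move=> oN /free_setP fJ XN Xf XJ; apply/free_setP=> S S0.
have [e eJ|Y YN YS] := fJ S; first by apply: S0; rewrite !inE eJ orbT.
wlog XS : X XN Xf XJ / X f = S f.
  move=> W; have Sf : S f != Zero by apply: S0; rewrite !inE eqxx.
  have [|ne] := eqVneq (X f) (S f); first exact: W.
  apply: (W (svopp X)); rewrite ?svoppE ?(covN oN) //.
  - by case: (X f) Xf.
  - by move=> e /XJ; rewrite svoppE => ->.
  - by move: Xf Sf ne; case: (X f); case: (S f).
exists (svcomp X Y) => [|e]; first exact: (covC oN).
rewrite in_setU1 svcompE => /predU1P[->|eJ]; first by rewrite (negPf Xf).
by rewrite XJ // eqxx YS.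
Qed.

(** Let J be a maximal subset of I that is free after contracting d.  If I had two
    more elements f and g, both would be spanned by J and d; eliminating d
    between covectors that isolate f and g in I contradicts this for f. *)
Lemma free_set_exchange N d I : covector_axioms N -> free_set N I ->
  exists J, [/\ free_set (contraction d N) J, J \subset I & (#|I| <= #|J|.+1)%N].
Proof.
move=> oN fI; pose P J := free_set (contraction d N) J && (J \subset I).
have P0 : P set0 by rewrite /P sub0set andbT; exact/free_set0/con_axioms.
have [J /andP[fJ JI] Jmax] := arg_maxnP (fun J => #|J|) P0; exists J; split=> //.
rewrite leqNgt; apply/negP=> ltJI.
have /card_gt1P[f [g [fIJ gIJ fg]]] : (1 < #|I :\: J|)%N.
  by rewrite -(ltn_add2l #|J|) addn1 (leq_trans ltJI) // -(cardsID J I) (setIidPr JI).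
move: fIJ gIJ; rewrite !inE => /andP[fJ' fI'] /andP[gJ' gI'].
have spanned h : h \in I -> h \notin J -> forall X, X \in N -> X h != Zero ->
    (forall e, e \in J -> X e = Zero) -> X d != Zero.
  move=> hI hJ X XN Xh XJ; apply/negP=> Xd.
  have /Jmax : P (h |: J).
    rewrite /P subUset sub1set hI JI !andbT.
    by apply: (free_set_extend (con_axioms d oN) fJ (X := X)); rewrite // in_con XN.
  by rewrite /= cardsU1 hJ add1n ltnn.
have [X XN XI] := free_pattern oN fI [ffun e => if e == f then Plus else Zero].
have [Y YN YI] := free_pattern oN fI [ffun e => if e == g then Plus else Zero].
have XJ e : e \in J -> X e = Zero.
  move=> eJ; rewrite XI ?(subsetP JI) // ffunE; case: eqP => // ef.
  by rewrite -ef eJ in fJ'.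
have YJ e : e \in J -> Y e = Zero.
  move=> eJ; rewrite YI ?(subsetP JI) // ffunE; case: eqP => // eg.
  by rewrite -eg eJ in gJ'.
have Yd : Y d != Zero by apply: (spanned g) YJ => //; rewrite YI // ffunE eqxx.
have [Z [ZN Zd Zf]] := eliminate oN XN YN Yd.
have : Z d != Zero; last by rewrite Zd.
apply: (spanned f) => //; last by move=> e eJ; rewrite Zf ?XJ ?YJ.
by rewrite Zf ?YI ?XI ?ffunE ?eqxx // (negPf fg).
Qed.

Lemma prefix_free_max N s T i I : covector_axioms N -> block_prefix N s T ->
  free_set N I -> I \subset union_blocks (take i s) -> (#|I| <= i)%N.
Proof.
elim: s N T i I => [|D s IHs] N T [|i] I oN /=.
1-3: by move=> _ _; rewrite /union_blocks big_nil subset0 => /eqP->; rewrite cards0.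
move=> [d [nd -> TN Td pT]] fI sI.
have [J [fJ JI leJ]] := free_set_exchange d oN fI.
apply: leq_trans leJ _; rewrite ltnS; apply: (IHs _ _ _ _ (con_axioms d oN) pT fJ).
apply/subsetP=> e eJ; have := subsetP sI e (subsetP JI e eJ).
by rewrite union_cons in_setU inE (free_set_nonloop fJ eJ) andbF.
Qed.
End Prefix.

(** * Prefix chains, their moments and their forms *)

Section Forms.
Variable E : finType.
Implicit Types (X Y Z T U V : signvec E).
Implicit Types (I J D S : {set E}) (d e f g j : E) (x y z c : chain E).
Implicit Types (s : seq {set E}) (q : polyE E).

Lemma coef_varM j q S : (varE j * q)@_(sqfree_mon S) =
  if j \in S then q@_(sqfree_mon (S :\ j)) else 0.
Proof.
rewrite mulrC; case: ifP => jS.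
  have -> : sqfree_mon S = (U_(enum_rank j) + sqfree_mon (S :\ j))%MM.
    apply/mnmP=> i; rewrite mnmDE mnm1E !mnmE !inE.
    have [<-|ij] := eqVneq (enum_rank j) i; first by rewrite enum_rankK eqxx jS.
    suff -> : enum_val i != j by [].
    by apply: contraNneq ij => <-; rewrite enum_valK.
  exact: mcoeffMX.
rewrite [q]mpolyE mulr_suml raddf_sum /=; apply: big1 => m _.
rewrite -scalerAl mcoeffZ -mpolyXD mcoeffX; case: eqP => [/mnmP/(_ (enum_rank j))|].
  by rewrite mnmDE mnm1E eqxx mnmE enum_rankK jS addn1.
by rewrite mulr0.
Qed.

Definition block_form s T : polyE E :=
  \prod_(D <- s) \sum_(j in D) (sign_int (T j))%:MP * varE j.

Lemma coef_block_form D s T S :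
  (block_form (D :: s) T)@_(sqfree_mon S) =
  \sum_(j in S :&: D) sign_int (T j) * (block_form s T)@_(sqfree_mon (S :\ j)).
Proof.
rewrite /block_form big_cons mulr_suml raddf_sum /= big_mkcond [RHS]big_mkcond /=.
apply: eq_bigr => j _; rewrite inE andbC; case: (j \in D) => //=.
by rewrite -mulrA mcoeffCM coef_varM; case: ifP; rewrite ?mulr0.
Qed.

Lemma positive_on_split S D T :
  positive_on S T = positive_on (S :&: D) T && positive_on (S :\: D) T.
Proof.
apply/forall_inP/andP=> [H|[/forall_inP h1 /forall_inP h2] e eS].
  by split; apply/forall_inP=> e; rewrite inE => /andP[? ?]; apply: H.
by have [eD|eD] := boolP (e \in D); [apply: h1|apply: h2]; rewrite inE eS ?eD.
Qed.

Lemma eq_positive_on S T U : {in S, T =1 U} -> positive_on S T = positive_on S U.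
Proof. by move=> TU; apply: eq_forallb_in => e /TU ->. Qed.

Lemma moment_basis S T : moment S (basis_chain T) = (positive_on S T)%:R.
Proof.
rewrite /moment /pairing (bigD1 T) //= ffunE eqxx mul1r big1 ?addr0 // => U /negPf UT.
by rewrite ffunE UT mul0r.
Qed.

Lemma moment_block_ext s S T U : {in S, T =1 U} ->
  moment S (block_chain s T) = moment S (block_chain s U).
Proof.
elim: s T U => [|D s IHs] T U TU /=; first by rewrite !moment_basis (eq_positive_on TU).
rewrite !momentB (IHs _ _ TU) (IHs (flip D T) (flip D U)) // => e eS.
by rewrite !flipE TU.
Qed.

Lemma moment_block_split s D S T : all (fun D' : {set E} => [disjoint D & D']) s ->
  moment S (block_chain s T) =
    (positive_on (S :&: D) T)%:R * moment (S :\: D) (block_chain s T).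
Proof.
elim: s T => [|D' s IHs] T /=.
  by move=> _; rewrite !moment_basis (positive_on_split S D) -mulnb natrM.
case/andP=> DD' ds; rewrite !momentB (IHs T) // (IHs (flip D' T)) //.
rewrite (@eq_positive_on _ (flip D' T) T) ?mulrBr // => e.
by rewrite inE flipE => /andP[_ eD]; rewrite (disjointFr DD' eD).
Qed.

Lemma moment_block_cons D s S T : all (fun D' : {set E} => [disjoint D & D']) s ->
  moment S (block_chain (D :: s) T) =
    ((positive_on (S :&: D) T)%:R - (positive_on (S :&: D) (svopp T))%:R) *
    moment (S :\: D) (block_chain s T).
Proof.
move=> ds; rewrite /= momentB (moment_block_split S T ds).
rewrite (moment_block_split S (flip D T) ds) mulrBl; congr (_ - _ * _).
  congr (nat_of_bool _)%:R; apply: eq_positive_on => e.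
  by rewrite inE flipE svoppE => /andP[_ ->].
by apply: moment_block_ext => e; rewrite inE flipE => /andP[/negPf->].
Qed.

Lemma card_setD_lt S D e : e \in S :&: D -> (#|S :\: D| < #|S|)%N.
Proof.
rewrite in_setI => /andP[eS eD]; apply/proper_card/properP; split.
  exact: subsetDl.
by exists e; rewrite // in_setD eD.
Qed.

Lemma moment_block_low s S T : pairwise (fun D D' : {set E} => [disjoint D & D']) s ->
  (#|S| < size s)%N -> moment S (block_chain s T) = 0.
Proof.
elim: s S T => [|D s IHs] S T //; rewrite pairwise_cons => /andP[ds ps] /=.
rewrite ltnS => Ss; rewrite -[_ - _]/(block_chain (D :: s) T) moment_block_cons //.
have [->|[e eSD]] := set_0Vmem (S :&: D); first by rewrite !positive_on0 subrr mul0r.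
by rewrite IHs ?mulr0 // (leq_trans (card_setD_lt eSD) Ss).
Qed.

(** Both sides satisfy the same recursion on the list of blocks.  If the first block
    D meets S in one element e, the two halves of the chain contribute the sign
    of T at e; if it meets S in no element or in more than one, both sides vanish,
    the latter case because too few elements remain for the other blocks. *)
Lemma moment_block_form s S T :
  pairwise (fun D D' : {set E} => [disjoint D & D']) s ->
  (forall D, D \in s -> D \subset supp T) -> (#|S| <= size s)%N ->
  moment S (block_chain s T) = (block_form s T)@_(sqfree_mon S).
Proof.
elim: s S => [|D s IHs] S.
  move=> _ _; rewrite leqn0 cards_eq0 => /eqP ->.
  rewrite moment_basis positive_on0 /block_form big_nil mcoeff1.
  rewrite (_ : _ == _) //; apply/eqP/mnmP=> i; by rewrite !mnmE inE.
rewrite pairwise_cons => /andP[ds ps] sT Ss.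
have IH S' : (#|S'| <= size s)%N ->
    moment S' (block_chain s T) = (block_form s T)@_(sqfree_mon S').
  by apply: IHs => // D' D's; apply: sT; rewrite inE D's orbT.
rewrite coef_block_form moment_block_cons //.
have -> : \sum_(j in S :&: D) sign_int (T j) *
      (block_form s T)@_(sqfree_mon (S :\ j)) =
    \sum_(j in S :&: D) sign_int (T j) * ((positive_on ((S :\ j) :&: D) T)%:R *
      moment (S :\: D) (block_chain s T)).
  apply: eq_bigr => j; rewrite in_setI => /andP[jS jD]; congr (_ * _).
  rewrite -IH; last first.
    by rewrite -ltnS; apply: leq_trans Ss; rewrite [X in (_ < X)%N](cardsD1 j) jS.
  rewrite (moment_block_split _ _ ds); congr (_ * moment _ _).
  by apply/setP=> e; rewrite !inE; case: (eqVneq e j) => [->|//]; rewrite jD.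
have [low|high] := ltnP #|S :\: D| (size s).
  rewrite moment_block_low // mulr0 big1 // => j _; by rewrite !mulr0.
have [SD0|[e eSD]] := set_0Vmem (S :&: D).
  by rewrite SD0 !positive_on0 subrr mul0r big_set0.
have SDe : S :&: D = [set e].
  apply/eqP; rewrite eq_sym eqEcard sub1set eSD cards1.
  by rewrite -(leq_add2r (size s)) (leq_trans _ Ss) // -(cardsID D S) leq_add2l.
rewrite SDe big_set1 mulrA; congr (_ * _).
have -> : (S :\ e) :&: D = set0.
  apply/setP=> f; have /setP/(_ f) := SDe; rewrite !inE.
  by case: (f == e) => //= ->.
have pos1 V : positive_on [set e] V = (V e == Plus).
  apply/forall_inP/idP=> [H|Ve f]; first by apply: H; rewrite inE.
  by rewrite inE => /eqP ->.
have Te : T e != Zero.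
  move: eSD; rewrite inE => /andP[_ /(subsetP (sT D (mem_head _ _)))].
  by rewrite inE.
by rewrite !pos1 positive_on0 svoppE; case: (T e) Te.
Qed.

Definition indicator D : {ffun E -> 'Z_2} := [ffun e => (e \in D)%:R].

Lemma tope_of_flip v D : tope_of (v + indicator D) = flip D (tope_of v).
Proof.
apply/ffunP=> e; rewrite flipE !ffunE; case: (e \in D); last by rewrite addr0.
by case: (v e) => -[|[|]].
Qed.

Lemma sum_ffun_cons (R : nmodType) n (F : {ffun 'I_n.+1 -> bool} -> R) :
  \sum_a F a = \sum_(b : bool) \sum_(a : {ffun 'I_n -> bool})
     F [ffun i => if unlift ord0 i is Some k then a k else b].
Proof.
rewrite pair_big /=.
rewrite (reindex (fun u : bool * {ffun 'I_n -> bool} =>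
    [ffun i => if unlift ord0 i is Some k then u.2 k else u.1])) //=.
exists (fun a => (a ord0, [ffun k => a (lift ord0 k)])) => [[b a] _|a _] /=.
  congr pair; first by rewrite ffunE unlift_none.
  by apply/ffunP=> k; rewrite !ffunE liftK.
by apply/ffunP=> i; rewrite ffunE; case: unliftP => [k ->|->]; rewrite ?ffunE.
Qed.

Lemma sum_block_chain s v :
  \sum_(a : {ffun 'I_(size s) -> bool})
     basis_chain (tope_of (v + \sum_(i < size s) indicator (nth set0 s i) *+ a i))
       *~ (-1) ^+ (\sum_(i < size s) a i)%N = block_chain s (tope_of v).
Proof.
elim: s v => [|D s IHs] v /=.
  rewrite (bigD1 [ffun=> false]) //= [X in _ + X]big1 ?addr0.
    by rewrite !big_ord0 addr0.
  by move=> a /eqP[]; apply/ffunP=> -[].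
rewrite sum_ffun_cons big_bool [LHS]addrC.
pose ext (b : bool) (a : {ffun 'I_(size s) -> bool}) : {ffun 'I_(size s).+1 -> bool} :=
  [ffun i => if unlift ord0 i is Some k then a k else b].
have ext0 b a : ext b a ord0 = b by rewrite ffunE unlift_none.
have extS b a i : ext b a (lift ord0 i) = a i by rewrite ffunE liftK.
have vecE b a : \sum_(i < (size s).+1) indicator (nth set0 (D :: s) i) *+ ext b a i =
    indicator D *+ b + \sum_(i < size s) indicator (nth set0 s i) *+ a i.
  rewrite big_ord_recl ext0; congr (_ + _).
  by apply: eq_bigr => i _; rewrite extS.
have cntE b a : (\sum_(i < (size s).+1) ext b a i = b + \sum_(i < size s) a i)%N.
  rewrite big_ord_recl ext0; congr (_ + _)%N.
  by apply: eq_bigr => i _; rewrite extS.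
rewrite -tope_of_flip -!IHs -sumrN; apply: (f_equal2 +%R).
  apply: eq_bigr => a _.
  by rewrite -/(ext false a) vecE cntE mulr0n add0r add0n.
apply: eq_bigr => a _.
by rewrite -/(ext true a) vecE cntE mulr1n addrA add1n exprS mulN1r mulrNz.
Qed.

End Forms.

Section DualVG.
Variables (E : finType) (N : orientedMatroid E).
Implicit Types (T : signvec E) (S : {set E}) (x : chain E).

Lemma eval_chainE f x : tope_chain N x -> eval_chain N f x = pairing f x.
Proof.
move=> tx; rewrite /eval_chain big_mkcond /=; apply: eq_bigr => T _.
by case: ifP => // /negbT/tx ->; rewrite mul0r.
Qed.

Lemma prod_bool (I : finType) (A : pred I) (P : pred I) :
  \prod_(i in A) (P i)%:R = [forall i in A, P i]%:R :> int.
Proof.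
have [/forall_inP H|/forall_inPn[i Ai Pi]] := boolP [forall i in A, P i].
  by apply: big1 => i /H ->.
by rewrite (bigD1 i) //= (negPf Pi) mul0r.
Qed.

(** At the 0-1 values of Heaviside functions, a monomial depends only on the set of
    its variables, whose cardinality is at most its degree. *)
Lemma dualVG_vg_dual p x : dualVG N p x <-> vg_dual (covectors N) p x.
Proof.
have tE : tope_chain N x <-> forall T, ~~ tope N T -> x T = 0.
  by split=> H T; move: (H T); rewrite mem_topes.
split=> -[tx mx]; split; try exact/tE.
  move=> S Sp; rewrite /moment -eval_chainE //; apply: mx.
  exists (\prod_(e in S) varE e).
    rewrite mprodXE msizeX mdeg_sum (eq_bigr (fun=> 1%N)); last first.
      by move=> *; exact: mdeg1.
    by rewrite sum1_card.
  move=> T _; rewrite rmorph_prod /= -prod_bool; apply: eq_bigr => e _.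
  by rewrite mevalXU enum_rankK.
move=> f [q qp fq]; rewrite eval_chainE; last exact/tE.
rewrite (@eq_pairing _ _ (fun T => q.@[fun i => heaviside (enum_val i) T])); last first.
  move=> T xT; apply: fq; rewrite mem_topes; apply: contraNT xT => /tx->; exact: eqxx.
rewrite /pairing; under eq_bigr do rewrite mevalE mulr_sumr.
rewrite exchange_big /=; apply: big1_seq => m /andP[_ mq].
pose S := [set e : E | m (enum_rank e) != 0%N].
under eq_bigr do rewrite mulrCA; rewrite -mulr_sumr.
suff -> : \sum_T x T * \prod_i heaviside (enum_val i) T ^+ m i = moment S x.
  rewrite mx ?mulr0 //.
  apply: leq_trans qp; apply: leq_ltn_trans (msize_mdeg_lt mq).
  rewrite mdegE (reindex _ (onW_bij _ (@enum_rank_bij E))) /= -sum1_card big_mkcond /=.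
  by apply: leq_sum => e _; rewrite inE; case: eqP => // /eqP; rewrite -lt0n.
apply: eq_bigr => T _; congr (_ * _).
rewrite -prod_bool (reindex _ (onW_bij _ (@enum_rank_bij E))) /= [RHS]big_mkcond /=.
apply: eq_bigr => e _; rewrite enum_rankK inE.
case: (m (enum_rank e)) => [|k] //=; rewrite /heaviside.
by case: (T e == Plus); rewrite ?expr1n // expr0n.
Qed.

Lemma prefix_vg_dual (L : {set signvec E}) s T : covector_axioms L ->
  block_prefix L s T -> vg_dual L (size s) (block_chain s T).
Proof.
elim: s L T => [|D s IHs] L T oL /=.
  move=> tT; split=> // V; rewrite ffunE; case: eqP => // ->; by rewrite tT.
move=> [d [nd -> TL Td pT]].
have [] := lift_block_chain oL TL Td pT.
have -> : svcomp (svset0 (parallel_class L d) T) T = T.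
  apply/ffunP=> e; rewrite svcompE svset0E; case: (e \in parallel_class L d) => //.
  by case: (T e).
move=> /= <- _; apply: (lift_vg_dual oL TL Td); exact: (IHs _ _ (con_axioms d oL) pT).
Qed.

End DualVG.

Section Flags.
Variables (E : finType) (N : orientedMatroid E).
Hypothesis loopN : forall e, nonloop N e.
Variables (s : seq {set E}) (T : signvec E).
Hypothesis ps : block_prefix N s T.
Hypothesis cover_s : forall e, exists2 D, D \in s & e \in D.

Definition union_flag := mkseq (fun i => union_blocks (take i s)) (size s).+1.

Let oN := om_axioms N.

Lemma union_flag_length : flag_length union_flag = size s.
Proof. by rewrite /flag_length size_mkseq. Qed.

Lemma union_flag_nth i : (i <= size s)%N ->
  flag_nth union_flag i = union_blocks (take i s).
Proof. by move=> si; rewrite /flag_nth nth_mkseq ?ltnS. Qed.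

Lemma in_union_blocks (r : seq {set E}) e :
  reflect (exists2 D, D \in r & e \in D) (e \in union_blocks r).
Proof.
rewrite /union_blocks; elim: r => [|D r IHr].
  by rewrite big_nil inE; constructor=> -[].
rewrite big_cons in_setU; apply: (iffP orP) => [[eD|/IHr[D' D'r eD']]|[D']].
- by exists D; rewrite ?mem_head.
- by exists D'; rewrite // inE D'r orbT.
- by rewrite inE => /predU1P[->|D'r] eD'; [left|right; apply/IHr; exists D'].
Qed.

Lemma union_flag_block i : (i < size s)%N ->
  flag_block union_flag i = nth set0 s i.
Proof.
move=> si; rewrite /flag_block !union_flag_nth // 1?ltnW //.
rewrite (take_nth set0) // /union_blocks -cats1 big_cat big_seq1 /=.
rewrite setDUl setDv set0U; apply/setDidPl; rewrite disjoint_sym.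
apply/pred0P=> e /=; apply/andP=> -[/in_union_blocks[D Ds eD] ei].
have := prefix_disjoint oN ps; rewrite -(cat_take_drop i s) pairwise_cat.
case/and3P=> /allrelP/(_ D (nth set0 s i) Ds) dis _ _.
have /dis/pred0P/(_ e) /= : nth set0 s i \in drop i s.
  by rewrite (drop_nth set0) // mem_head.
by rewrite eD ei.
Qed.

Lemma union_flagP : is_flag N union_flag.
Proof.
apply/and5P; split.
- by [].
- by rewrite -/(flag_nth _ 0) union_flag_nth // take0 /union_blocks big_nil.
- apply/eqP; rewrite -nth_last size_mkseq /= nth_mkseq // take_size.
  by apply/setP=> e; rewrite inE; apply/in_union_blocks/cover_s.
- apply/(sortedP setT) => i; rewrite size_mkseq ltnS => si.
  rewrite -!/(flag_nth union_flag _) properEneq.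
  have sub : flag_nth union_flag i \subset flag_nth union_flag i.+1.
    rewrite !union_flag_nth // 1?ltnW //; apply/subsetP=> e /in_union_blocks[D Ds eD].
    apply/in_union_blocks; exists D => //.
    move: Ds; rewrite (take_nth set0) // mem_rcons inE => ->.
    exact: orbT.
  rewrite sub andbT; apply/eqP=> eq.
  have := union_flag_block si; rewrite /flag_block eq setDv => /esym.
  by have [/eqP] := prefix_nonloop oN ps (mem_nth set0 si).
apply/allP=> _ /mapP[i + ->]; rewrite mem_iota add0n ltnS => /= si.
apply/imsetP; exists (svset0 (union_blocks (take i s)) T).
  exact: prefix_truncate.
have /topeP[_ T0] := prefix_tope oN ps.
apply/setP=> e; rewrite !inE negbK svset0E; case: ifP => // _.
by apply/esym/negbTE/T0.
Qed.

Definition blocks_flag := Flag union_flagP.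

Lemma blocks_flag_complete : complete_flag blocks_flag.
Proof.
move=> i; rewrite union_flag_length => si; rewrite union_flag_nth //; apply/eqP.
rewrite eqn_leq; apply/andP; split.
  apply/bigmax_leqP=> I /andP[]; rewrite independent_free => fI.
  exact: (prefix_free_max oN ps).
have [I [fI sI cI]] := prefix_free oN ps si.
rewrite -[X in (X <= _)%N]cI /rank.
apply: (@leq_bigmax_cond _
  (fun I : {set E} => independent N I && (I \subset _)) (fun I => #|I|)).
by rewrite independent_free fI.
Qed.

Lemma blocks_flag_tope : T \in flag_topes blocks_flag.
Proof.
rewrite inE mem_topes (prefix_tope oN ps); apply/forallP=> -[i iG].
have si : (i <= size s)%N by move: iG; rewrite size_mkseq ltnS.
rewrite [flag_nth _ _]union_flag_nth //.
exact: prefix_truncate.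
Qed.
End Flags.

(** The map of the statement is evaluation on squarefree monomials of degree p: both
    are additive, and they agree on the prefix chains, which span. *)
Lemma atilde_moment (E : finType) (N : orientedMatroid E) p a x :
  (forall e, nonloop N e) -> is_atilde N p a -> dualVG N p x ->
  forall S : {set E}, #|S| = p -> a x S = moment S x.
Proof.
move=> loopN [_ lin gen] dx.
have oN := om_axioms N.
pose K y := dualVG N p y /\ forall S : {set E}, #|S| = p -> a y S = moment S y.
suff [] : K x by [].
have d0 : dualVG N p 0 by apply/dualVG_vg_dual/vg_dual0.
have a0 : a 0 = 0.
  have := lin 1 0 0 d0 d0; rewrite addr0 mul0rz mulr1z => /esym/(canRL (addrK _)).
  by rewrite subrr.
apply: (prefix_span oN (x := x) (p := p)); first exact/dualVG_vg_dual.
  split; first by split=> // S _; rewrite a0 ffunE [moment _ _]pairing0.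
  move=> y z [dy ay] [dz az]; split.
    by apply/dualVG_vg_dual/vg_dualB; exact/dualVG_vg_dual.
  move=> S Sp; rewrite momentB -ay // -az //.
  have -> : y - z = z *~ (-1) + y by rewrite mulrNz mulr1z addrC.
  by rewrite lin // mulrNz mulr1z addrC ffunE [(- a z) S]ffunE.
move=> s T sp ps; split.
  by apply/dualVG_vg_dual; rewrite -sp; apply: prefix_vg_dual.
move=> S Sp; have [s' [ps' cov]] := prefix_extend oN ps.
have {}cov e : exists2 D, D \in s ++ s' & e \in D by exact/cov.
pose G := blocks_flag loopN ps' cov.
have /topeP[_ T0] := prefix_tope oN ps.
pose v : {ffun E -> 'Z_2} := [ffun e => (T e == Minus)%:R].
have Tv : tope_of v = T.
  by apply/ffunP=> e; rewrite !ffunE; have := T0 e (loopN e); case: (T e).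
have ps_nth i : (i < p)%N -> flag_block G i = nth set0 s i.
  move=> ip; rewrite (union_flag_block ps') ?nth_cat ?sp ?ip //.
  by rewrite size_cat sp ltn_addr.
have pG : (p <= flag_length G)%N by rewrite union_flag_length size_cat sp leq_addr.
have cG : complete_flag G by exact: blocks_flag_complete.
have := gen G v cG; rewrite Tv.
have -> : prefix_chain G v p = block_chain s T.
  rewrite -Tv -sum_block_chain sp; apply: eq_bigr => b _.
  suff -> : \sum_(i < p) block_vec G i *+ b i =
      \sum_(i < p) indicator (nth set0 s i) *+ b i by [].
  by apply: eq_bigr => i _; congr (_ *+ _); apply/ffunP=> e; rewrite !ffunE ps_nth.
have -> : prefix_form G v p = sqfree_class (block_form s T).
  rewrite /prefix_form Tv /block_form (big_nth set0) big_mkord sp.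
  by congr sqfree_class; apply: eq_bigr => i _; rewrite ps_nth.
move=> -> //; last exact: blocks_flag_tope.
rewrite ffunE moment_block_form ?sp ?Sp //.
- exact: prefix_disjoint oN ps.
- exact: prefix_supp oN ps.
Qed.

Theorem proposition1p1 (E : finType) (M : orientedMatroid E)
    (hM : loopless M) (F F' : flag M)
    (hFF' : {subset flag_seq F <= flag_seq F'}) (p : nat) :
  [/\ forall x : chain E, dualVG (initial F') p x -> dualVG (initial F) p x,
      forall f : SFSym E,
        cordovil_dual (initial F') p f -> cordovil_dual (initial F) p f
    & forall a' a : chain E -> SFSym E,
        is_atilde (initial F') p a' -> is_atilde (initial F) p a ->
        forall x : chain E, dualVG (initial F') p x -> a' x = a x].
Proof.
have incl x : dualVG (initial F') p x -> dualVG (initial F) p x.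
  move=> /dualVG_vg_dual[tx mx]; apply/dualVG_vg_dual; split=> // T nT.
  by apply: tx; apply: contraNN nT; apply: initial_tope.
split; first exact: incl.
  by move=> f [f0 fq]; split=> // q qp /(initial_ideal hFF'); apply: fq.
move=> a' a ha' ha x dx; apply/ffunP=> S.
have [Sp|Sp] := eqVneq #|S| p.
  rewrite (atilde_moment _ ha' dx Sp); last exact: initial_nonloop.
  by rewrite (atilde_moment _ ha (incl x dx) Sp) //; exact: initial_nonloop.
have [[d' _ _] [d _ _]] := (ha', ha).
by rewrite (d' x dx).1 // (d x (incl x dx)).1.
Qed.
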